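(* Let $n\ge0$ be an integer, let $g\in\mathbb{F}_q[T]$ be monic with $\deg(g)\ge1$, let $\ell\in\mathbb{F}_q[T]$ be monic with $\ell\ne1$ and $\ell\mid g$, and let $c\in\mathbb{F}_q[T]$ be such that $(c,g)=1$. Let $\chi$ be a primitive Dirichlet character modulo $\ell$. Then $$\sum_{f\in\mathcal{M}_n} r_\chi(f)e\Big(\frac{cf}{g}\Big)=\frac{q^n}{|g|}G(\chi)\overline\chi(c)L(1,\overline\chi)+\frac{q^n}{|g|}\overline\chi(-c)\sum_{\lambda\in\mathbb{F}_q^\times}\ \sum_{\eta_1,\eta_2\in\{0,1\}}\ \sum_{0\le k\le\nu} b_{\nu-k}(\chi;\lambda,\eta_1,\eta_2)\sum_{f\in\mathcal{M}_k} r_\chi(f)e\Big(\frac{\lambda\overline{c}f}{g}\Big),$$ where $\overline c$ is an inverse of $c$ modulo $g$, $\nu=2\deg(g)-n-2$, and $$b_k(\chi;\lambda,\eta_1,\eta_2)=(-1)^{k-\eta_1-\eta_2}\,\mathrm{Kl}_\chi\big(\eta_1-1,(1-\eta_2)\lambda\big)\,\mathbf{1}_{k\ge\eta_1+\eta_2}\binom{-\eta_1-\eta_2}{k-\eta_1-\eta_2}.$$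
   Context: $q=p^\eta$ is a prime power; $e_q(y)=\exp(2\pi i\,\mathrm{Tr}_{\mathbb{F}_q/\mathbb{F}_p}(y)/p)$ for $y\in\mathbb{F}_q$; for $\alpha=\sum_{j\le N}\alpha_jT^j\in\mathbb{F}_q((1/T))$, $e(\alpha)=e_q(\alpha_{-1})$. $\mathcal{M}_n$ is the set of monic polynomials of degree $n$ in $\mathbb{F}_q[T]$; $|f|=q^{\deg f}$. $r_\chi(f)=\sum_{g\mid f}\chi(g)$ over monic divisors $g$. $G(\chi)=\sum_{a\ (\mathrm{mod}\ \ell)}\chi(a)e(a/\ell)$. $L(s,\chi)=\sum_{f\text{ monic}}\chi(f)|f|^{-s}$ (continued analytically). For $\alpha,\beta\in\mathbb{F}_q$, $\mathrm{Kl}_\chi(\alpha,\beta)=\sum_{\gamma\in\mathbb{F}_q^\times}\chi(\gamma)e_q(\alpha\gamma+\beta\gamma^{-1})$ (using the restriction of $\chi$ to $\mathbb{F}_q^\times$). Binomials are generalized: $\binom{x}{j}=x(x-1)\cdots(x-j+1)/j!$. A sum over $0\le k\le\nu$ is empty if $\nu<0$. *)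

(* Defs.v *)
From HB Require Import structures.
From mathcomp Require Import all_boot all_order all_algebra all_fingroup all_field.
From mathcomp Require Import finmap.
From mathcomp Require Import complex zify.
From mathcomp Require Import all_classical all_reals all_analysis summability.

Set Implicit Arguments.
Unset Strict Implicit.
Unset Printing Implicit Defensive.

Import Order.TTheory GRing.Theory Num.Theory.
Import numFieldNormedType.Exports.

Local Open Scope classical_set_scope.
Local Open Scope ring_scope.
Local Open Scope complex_scope.

Definition cexp {R : realType} (z : R[i]) : R[i] :=
  (expR (complex.Re z))%:C *
  (cos (complex.Im z) +i* sin (complex.Im z)).

(* [sum_j (lcoef j) T^j] with finitely many nonzero terms of positive index *)
Record laurent (F : fieldType) := Laurent {
  lcoef :> int -> F;
  _ : exists N : int, forall j : int, N < j -> lcoef j = 0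
}.

(* Coefficients of a / g: for every k >= -j, the coefficient of T^j in a / g
   is that of T^(j + k) in the polynomial part of T^k a / g. *)
Definition frac_coef (F : fieldType) (a g : {poly F}) (j : int) : F :=
  match j with
  | Posz m => (a %/ g)`_m
  | Negz m => (('X^(m.+1) * a) %/ g)`_0
  end.

Lemma frac_coef_bounded (F : fieldType) (a g : {poly F}) :
  exists N : int, forall j : int, N < j -> frac_coef a g j = 0.
Proof.
exists (size (a %/ g)) => -[m|m] //= hm.
by rewrite nth_default // ltnW.
Qed.

Definition laurent_frac (F : fieldType) (a g : {poly F}) : laurent F :=
  Laurent (frac_coef_bounded a g).

Lemma frac_coef_shift (F : fieldType) (a g : {poly F}) (k m : nat) :
  g != 0 -> (('X^k * a) %/ g)`_m = frac_coef a g (m%:Z - k%:Z).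
Proof.
move=> g0.
have step k' m' : (('X^(k'.+1) * a) %/ g)`_m'.+1 = (('X^k' * a) %/ g)`_m'.
  rewrite exprS -mulrA [in LHS](divp_eq ('X^k' * a) g) mulrDr mulrA.
  rewrite divpD mulpK // coefD coefXM /= [X in _ + X]nth_default ?addr0 //.
  have [->|r0] := eqVneq (('X^k' * a) %% g) 0.
    by rewrite mulr0 div0p size_poly0.
  rewrite size_divp // mulrC size_mulX //.
  move: (ltn_modpN0 ('X^k' * a) g0); case: (size g) => [//|d].
  by rewrite ltnS leq_subLR addnS ltnS => /leq_trans -> //; rewrite leq_addr.
elim: k m => [|k IH] [|m].
- by rewrite expr0 mul1r.
- by rewrite expr0 mul1r subr0.
- by rewrite sub0r -NegzE.
- by rewrite step IH; congr frac_coef; rewrite -addn1 -(addn1 k) !PoszD opprD addrACA subrr addr0.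
Qed.

(* The product of [g] and [laurent_frac a g] in F((1/T)) is [a]. *)
Lemma laurent_fracE (F : fieldType) (a g : {poly F}) (j : int) : g != 0 ->
  \sum_(i < size g) g`_i * laurent_frac a g (j - i%:Z) =
  if j is Posz m then a`_m else 0.
Proof.
move=> g0; pose k := (size g + `|j|)%N; pose M := absz (j + k%:Z).
have jM : j = M%:Z - k%:Z by rewrite /M /k; lia.
have gM : (size g <= M)%N by rewrite /M /k; lia.
transitivity (('X^k * a) %/ g * g)`_M.
  rewrite mulrC coefM.
  have <- : (size g + (M.+1 - size g))%N = M.+1 by lia.
  rewrite big_split_ord /= [X in _ = _ + X]big1 ?addr0; last first.
    by move=> i _; rewrite nth_default ?mul0r // leq_addr.
  apply: eq_bigr => i _; congr (_ * _); rewrite frac_coef_shift //.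
  have iM : (i <= M)%N by rewrite (leq_trans (ltnW (ltn_ord i))).
  by rewrite -subzn // jM addrAC.
have := congr1 (fun h : {poly F} => h`_M) (divp_eq ('X^k * a) g).
rewrite coefD [X in _ + X]nth_default ?addr0 => [<-|]; last first.
  by rewrite (leq_trans _ gM) // ltnW // ltn_modpN0.
rewrite coefXnM; case: ltnP => kM; case: (j) jM => m jM.
- lia.
- by [].
- by congr (a`_ _); lia.
- lia.
Qed.

Section AdditiveCharacters.
Variables (R : realType) (p : nat) (F : finFieldType).
Hypothesis pcharF : p \in [pchar F].

Definition absolute_trace (y : F) : 'F_p :=
  odflt 0 [pick k : 'F_p |
    k%:A == galTrace 1%VS {:pPrimeCharType pcharF} (y : pPrimeCharType pcharF)].

Lemma absolute_traceP (y : F) :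
  (absolute_trace y)%:A =
  galTrace 1%VS {:pPrimeCharType pcharF} (y : pPrimeCharType pcharF).
Proof.
rewrite /absolute_trace; case: pickP => [k /eqP //|noK].
have : galTrace 1%VS {:pPrimeCharType pcharF} y \in (1%VS : {vspace pPrimeCharType pcharF}).
  apply: (@mem_galTrace _ _ 1%AS); last exact: memvf.
  by apply: (@finField_galois 'F_p (pPrimeCharType pcharF) 1%AS); rewrite sub1v.
by case/vlineP=> k tr_k; have := noK k; rewrite tr_k eqxx.
Qed.

Definition e_q (y : F) : R[i] :=
  cexp ('i * ((2 * pi * (absolute_trace y)%:R / p%:R)%R)%:C).

Definition e_laurent (alpha : laurent F) : R[i] := e_q (alpha (- 1%Z)).

Definition e_frac (a g : {poly F}) : R[i] := e_laurent (laurent_frac a g).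

End AdditiveCharacters.

Section Polynomials.
Variable F : finFieldType.

Definition monic_of_degree (n : nat) (f : {poly F}) : bool :=
  (f \is monic) && (size f == n.+1).

(* |f| = q ^ deg f, for f != 0 *)
Definition norm_poly (f : {poly F}) : nat := (#|F| ^ (size f).-1)%N.

End Polynomials.

Section Characters.
Variables (R : realType) (F : finFieldType).
Implicit Types (l d f : {poly F}) (chi psi : {poly F} -> R[i]).

(* Characters of (F_q[T] / l)^*, extended by 0 and lifted to F_q[T] *)
Record dirichlet_character l chi : Prop := {
  character_periodic : forall a b : {poly F}, l %| a - b -> chi a = chi b;
  character_one : chi 1 = 1;
  character_mul : forall a b : {poly F}, chi (a * b) = chi a * chi b;
  character_support : forall a : {poly F}, (chi a != 0) = coprimep a l
}.

Definition induced_from l d chi : Prop :=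
  exists2 psi : {poly F} -> R[i], dirichlet_character d psi &
    forall a : {poly F}, coprimep a l -> chi a = psi a.

Definition primitive_character l chi : Prop :=
  dirichlet_character l chi /\
  forall d, d \is monic -> d %| l -> induced_from l d chi -> d = l.

Definition conj_character chi : {poly F} -> R[i] := fun f => (chi f)^*.

Definition r_char chi f : R[i] :=
  \sum_(d : {poly_(size f) F} |
      ((d : {poly F}) \is monic) && ((d : {poly F}) %| f)) chi d.

Definition L_term chi (s : R[i]) f : R[i] :=
  if f \is monic then chi f * cexp (- s * (ln (norm_poly f)%:R)%:C) else 0.

(* [Lam] is entire and, for Re s > 1, is the (unordered) sum of the series
   [sum_(f monic) chi(f) |f|^-s]; for non-principal [chi] there is exactly one
   such function, which is a polynomial in q^-s. *)
Definition continues_L_series chi (Lam : R[i] -> R[i]) : Prop :=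
  (forall s : R[i], derivable (Lam : R[i]^o -> R[i]^o) s 1) /\
  (forall s : R[i], 1 < complex.Re s ->
     partial_sum (L_term chi s : {poly F} -> R[i]^o) @ totally -->
       (Lam s : R[i]^o)).

(* Zero when there is no entire continuation. *)
Definition L_function chi : R[i] -> R[i] :=
  xget (fun=> 0) [set Lam | continues_L_series chi Lam].

End Characters.

Section ExponentialSums.
Variables (R : realType) (p : nat) (F : finFieldType).
Hypothesis pcharF : p \in [pchar F].
Implicit Types (chi : {poly F} -> R[i]) (l : {poly F}).

(* The residues modulo l are represented by the polynomials of degree < deg l. *)
Definition gauss_sum l chi : R[i] :=
  \sum_(a : {poly_(size l).-1 F}) chi a * e_frac R pcharF a l.

Definition kloosterman chi (alpha beta : F) : R[i] :=
  \sum_(gamma : F | gamma != 0)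
    chi gamma%:P * e_q R pcharF (alpha * gamma + beta * gamma^-1).

Definition gbinom (x : R[i]) (j : nat) : R[i] :=
  (\prod_(i < j) (x - i%:R)) / j`!%:R.

Definition b_coef chi (k : nat) (lam : F) (eta1 eta2 : nat) : R[i] :=
  if (eta1 + eta2 <= k)%N then
    (-1) ^+ (k - (eta1 + eta2))
    * kloosterman chi (eta1%:R - 1) ((1 - eta2%:R) * lam)
    * gbinom (- (eta1 + eta2)%:R) (k - (eta1 + eta2))
  else 0.

End ExponentialSums.

(* Main.v *)
(* Write [f = d h] with [chi] evaluated at [d]. The sum over monic [h] of degree [j]
   of [e (c d h / g)] is [q^j e_q(a_t)], with [t = deg g - 1 - j], if the residue [a]
   of [c d] modulo [g] has degree at most [t], and 0 otherwise. So the left-hand side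
   is a sum over pairs [(d, a)] with [a = c d] modulo [g], and since [chi d] is
   [conj (chi c) chi a], this relation is symmetric up to exchanging [c] with its
   inverse: the sums on the right are over the same pairs, in the opposite order.
   The coefficients [b] are those for which the sum over [lambda] undoes the weights
   [e_q(a_t)] by orthogonality, up to a constant -1. That constant contributes
   [- sum_(t <= nu) U_t], where [U_t] is the sum of [chi a e_q(a_t)] over [deg a <= t].
   Expanding each [G(chi) conj (chi f)] as a twisted Gauss sum, which primitivity
   allows for every [f], gives [G(chi) L(1, conj chi) = sum_t U_t]; the part of it with
   [t > nu] accounts for the [d] of degree at least [deg g], which are equidistributed
   modulo [g]. *)
Require Import Defs.
From HB Require Import structures.
From mathcomp Require Import all_boot all_order all_algebra all_fingroup all_field.
From mathcomp Require Import finmap.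
From mathcomp Require Import complex zify ring lra.
From mathcomp Require Import all_classical all_reals all_analysis summability.

Set Implicit Arguments.
Unset Strict Implicit.
Unset Printing Implicit Defensive.

Import Order.TTheory GRing.Theory Num.Theory.
Import numFieldNormedType.Exports.

Local Open Scope ring_scope.
Local Open Scope complex_scope.

(** * Sums over polynomials of bounded degree *)

Section BoundedDegreeSums.
Variable F : finFieldType.
Implicit Types (f g h : {poly F}).

(** [u] and [v] act on plain polynomials and need only be inverse to each other within the degree
    bounds. This spares later substitutions the passage between [{poly_N F}] and [{poly_M F}]. *)
Lemma sum_npoly_reindex (V : nmodType) N M (P Q : pred {poly F})
    (u v : {poly F} -> {poly F}) (E : {poly F} -> V) :
  (forall f, (size f <= N)%N -> P f ->
     [/\ (size (u f) <= M)%N, Q (u f) & v (u f) = f]) ->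
  (forall f, (size f <= M)%N -> Q f ->
     [/\ (size (v f) <= N)%N, P (v f) & u (v f) = f]) ->
  \sum_(f : {poly_M F} | Q f) E f = \sum_(f : {poly_N F} | P f) E (u f).
Proof.
move=> uP vP.
rewrite (reindex_onto (fun f : {poly_N F} => npolyp M (u f))
                      (fun f : {poly_M F} => npolyp N (v f))) /=; last first.
  move=> f Qf; apply/val_inj => /=.
  have [sv Pv uv] := vP f (size_npoly f) Qf.
  by rewrite !npolypK // uv // size_npoly.
apply: eq_big => [f|f /andP[Qf /eqP vf]].
  apply/andP/idP => [[Qf /eqP vf]|Pf].
    have [sv Pv _] := vP _ (size_npoly _) Qf.
    by rewrite -vf npolypK.
  have [su Qu vu] := uP f (size_npoly f) Pf.
  rewrite npolypK //; split=> //; apply/eqP/val_inj => /=.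
  by rewrite npolypK vu // size_npoly.
have [sv Pv uv] := vP _ (size_npoly _) Qf.
move: vf => /(congr1 val) /=; rewrite (npolypK sv) => vf.
have Pf : P f by rewrite -vf.
by have [su _ _] := uP f (size_npoly f) Pf; rewrite npolypK.
Qed.

Lemma sum_npoly_widen (V : nmodType) N M (P : pred {poly F}) (E : {poly F} -> V) :
  (N <= M)%N ->
  \sum_(f : {poly_N F} | P f) E f =
  \sum_(f : {poly_M F} | (size f <= N)%N && P f) E f.
Proof.
move=> NM; symmetry.
rewrite (@sum_npoly_reindex _ N M P (fun f => (size f <= N)%N && P f) id id) //.
- by move=> f sf Pf; rewrite sf Pf (leq_trans sf).
- by move=> f _ /andP[].
Qed.

Lemma size_monic_subXn n f : monic_of_degree n f -> (size (f - 'X^n)%R <= n)%N.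
Proof.
case/andP=> /monicP lf /eqP sf; apply/leq_sizeP => j nj.
rewrite coefB coefXn; move: lf; rewrite /lead_coef sf /= => lf.
case: ltngtP nj => // [nj _|<- _]; last by rewrite lf subrr.
by rewrite nth_default ?subr0 // sf.
Qed.

Lemma monic_of_degreeXnD n h : (size h <= n)%N -> monic_of_degree n ('X^n + h).
Proof.
move=> sh; have s : (size h < size ('X^n : {poly F}))%N by rewrite size_polyXn ltnS.
by rewrite /monic_of_degree monicE lead_coefDl // lead_coefXn size_polyDl // size_polyXn !eqxx.
Qed.

(** This makes the monic polynomials a translate of an additive group, on which character sums can
    be evaluated. *)
Lemma sum_monic_shift (V : nmodType) n (E : {poly F} -> V) :
  \sum_(f : {poly_n.+1 F} | monic_of_degree n f) E f =
  \sum_(h : {poly_n F}) E ('X^n + h).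
Proof.
rewrite (@sum_npoly_reindex _ n n.+1 predT (monic_of_degree n)
          (fun h => 'X^n + h) (fun f => f - 'X^n)) //.
- move=> f sf _; rewrite monic_of_degreeXnD //; split=> //; last by rewrite addrC addKr.
  by case/andP: (monic_of_degreeXnD sf) => _ /eqP ->.
- by move=> f sf mf; rewrite size_monic_subXn //; split=> //; rewrite addrC subrK.
Qed.

Lemma sum_npoly_const (V : nmodType) n (x : V) :
  \sum_(h : {poly_n F}) x = x *+ (#|F| ^ n).
Proof. by rewrite sumr_const card_npoly. Qed.

Lemma sum_monic_const (V : nmodType) n (x : V) :
  \sum_(f : {poly_n.+1 F} | monic_of_degree n f) x = x *+ (#|F| ^ n).
Proof. by rewrite (sum_monic_shift _ (fun=> x)) sum_npoly_const. Qed.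

(** The zero polynomial has size 0 and falls in no degree class, hence the condition on [P]. *)
Lemma sum_npoly_by_degree (V : nmodType) N (P : pred {poly F}) (E : {poly F} -> V) :
  ~~ P 0 ->
  \sum_(f : {poly_N F} | P f) E f =
  \sum_(k < N) \sum_(f : {poly_k.+1 F} | P f && (size f == k.+1)) E f.
Proof.
move=> P0; case: N => [|N].
  rewrite big_ord0 big1 // => f Pf; have := size_npoly f; rewrite leqn0 size_poly_eq0.
  by move=> /eqP f0; rewrite f0 (negPf P0) in Pf.
rewrite (partition_big (fun f : {poly_N.+1 F} => inord (size f).-1 : 'I_N.+1) xpredT) //=.
apply: eq_bigr => k _; rewrite (@sum_npoly_widen V k.+1 N.+1 (fun f => P f && (size f == k.+1))) ?ltn_ord //.
apply: eq_bigl => f; apply/andP/and3P => [[Pf /eqP kf]|[sf Pf /eqP kf]].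
  have f0 : size f != 0%N by rewrite size_poly_eq0; apply: contraNneq P0 => <-.
  have sfN := size_npoly f.
  have kE : size f = k.+1.
    by rewrite -kf inordK prednK ?lt0n // -ltnS prednK ?lt0n // ltnS.
  by rewrite kE leqnn.
by split=> //; rewrite kf inord_val.
Qed.

Lemma sum_monic_by_degree (V : nmodType) N (E : {poly F} -> V) :
  \sum_(f : {poly_N F} | (f : {poly F}) \is monic) E f =
  \sum_(k < N) \sum_(f : {poly_k.+1 F} | monic_of_degree k f) E f.
Proof.
rewrite (@sum_npoly_by_degree _ _ (fun f => f \is monic)) //.
by rewrite monicE lead_coef0 eq_sym oner_eq0.
Qed.

End BoundedDegreeSums.

(** * The value of the L-function at 1 *)

Section ComplexExponential.
Variable R : realType.
Implicit Types (z w : R[i]) (x y : R).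

Lemma cexpD z w : cexp (z + w) = cexp z * cexp w.
Proof.
case: z w => a b [c d]; rewrite /cexp /= expRD cosD sinD.
by apply/eqP; rewrite eq_complex /=; apply/andP; split; apply/eqP; ring.
Qed.

Lemma cexp0 : cexp (0 : R[i]) = 1.
Proof. by rewrite /cexp /= expR0 cos0 sin0 mul1r. Qed.

Lemma norm_cexp z : `|cexp z| = (expR (complex.Re z))%:C.
Proof.
rewrite /cexp normrM !normc_def /= expr0n addr0 sqrtr_sqr cos2Dsin2 sqrtr1 mulr1.
by rewrite ger0_norm ?expR_ge0.
Qed.

Lemma cexp_natM n z : cexp (n%:R * z) = cexp z ^+ n.
Proof.
elim: n => [|n IH]; first by rewrite mul0r cexp0 expr0.
by rewrite -natr1 mulrDl mul1r cexpD IH exprSr.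
Qed.

Lemma cexp_real x : cexp x%:C = (expR x)%:C.
Proof. by rewrite /cexp /= cos0 sin0 mulr1. Qed.

Lemma normc_ge_Im z : `|complex.Im z|%:C <= `|z|.
Proof. by rewrite normc_def lecR -sqrtr_sqr ler_wsqrtr // lerDr sqr_ge0. Qed.

(** Clearing the denominator makes the estimate hold at [x = 0] too, which matters when one
    coordinate of a complex number vanishes. *)
Lemma derivative_at0 (f : R -> R) (c eps : R) : is_derive (0 : R) (1 : R) f c -> 0 < eps ->
  \forall x \near 0, `|f x - f 0 - c * x| <= eps * `|x|.
Proof.
move=> [df Df] e0.
have /cvg_ex [L hL] := df.
have EL : L = c by rewrite -Df; apply/esym/cvg_lim.
rewrite EL in hL.
move/cvgrPdist_le : hL => /(_ _ e0).
move=> H.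
have {}H : \forall x \near (0:R), x != 0 ->
    `|c - x^-1 *: ((f \o shift 0) (x *: 1) - f 0)| <= eps.
  by move: H; rewrite /dnbhs near_withinE.
apply: filterS H => x Hx; have [->|x0] := eqVneq x 0.
  by rewrite mulr0 subrr subr0 normr0 mulr0.
have := Hx x0; rewrite /= addr0 /GRing.scale /= mulr1 => h.
have -> : f x - f 0 - c * x = - ((c - x^-1 * (f x - f 0)) * x) by field.
by rewrite normrN normrM ler_wpM2r.
Qed.

(** Complex differentiability of the exponential at 0, from the real derivatives of [expR], [cos]
    and [sin] in the two coordinates. *)
Lemma cexp_expansion (eps : R) : 0 < eps -> exists2 del : R, 0 < del &
  forall z, `|z| < del%:C -> `|cexp z - 1 - z| <= eps%:C * `|z|.
Proof.
(* The errors below add up to [e (|a| + 5 |b|)], which is at most [6 e |z|]. *)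
move=> e0; pose e := eps / 6%:R.
have ep : 0 < e by rewrite divr_gt0.
have epsE : eps = e * 6%:R by rewrite divfK.
clearbody e.
have He : \forall x \near (0:R), `|expR x - 1 - x| <= e * `|x|.
  have /derivative_at0 -/(_ _ ep) := is_derive_expR (0:R).
  by rewrite expR0; apply: filterS => x; rewrite mul1r.
have Hs : \forall x \near (0:R), `|sin x - x| <= e * `|x|.
  have /derivative_at0 -/(_ _ ep) := is_derive_sin (0:R).
  by rewrite cos0 sin0; apply: filterS => x; rewrite mul1r subr0.
have Hc : \forall x \near (0:R), `|cos x - 1| <= e * `|x|.
  have /derivative_at0 -/(_ _ ep) := is_derive_cos (0:R).
  by rewrite cos0 sin0; apply: filterS => x; rewrite oppr0 mul0r subr0.
(* The bound 1 yields [expR a <= 2]; the bound [e] controls the cross term [(expR a - 1) b]. *)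
have Hx : \forall x \near (0:R), `|expR x - 1| <= Num.min 1 e.
  have /cvgrPdist_le := @continuous_expR R 0.
  move=> /(_ (Num.min 1 e)); rewrite lt_min ltr01 ep => /(_ isT).
  by rewrite expR0; apply: filterS => x; rewrite distrC.
have : \forall x \near (0:R), [/\ `|expR x - 1 - x| <= e * `|x|,
   `|sin x - x| <= e * `|x|, `|cos x - 1| <= e * `|x| & `|expR x - 1| <= Num.min 1 e].
  by near=> x; split; near: x.
move=> /nbhs_ballP [del /= del0 H]; exists del => // -[a b] hz.
have ha : `|a| < del by rewrite -ltcR (le_lt_trans (normc_ge_Re _) hz).
have hb : `|b| < del by rewrite -ltcR (le_lt_trans (normc_ge_Im _) hz).
have Ha := H a; have Hb := H b; rewrite /ball /= !sub0r !normrN in Ha Hb.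
case: (Ha ha) => ea _ _ ea1; case: (Hb hb) => _ sb cb _ {Ha Hb H}.
move: ea1; rewrite le_min => /andP[ea1 ea2].
have ea3 : `|expR a| <= 2.
  rewrite -[X in `|X|](subrK 1) (le_trans (ler_normD _ _)) // normr1.
  by have -> : 2 = 1 + 1 :> R by []; rewrite lerD2r.
pose z : R[i] := a +i* b; rewrite -/z in hz *.
have za : `|a|%:C <= `|z| := normc_ge_Re z.
have zb : `|b|%:C <= `|z| := normc_ge_Im z.
pose u := expR a - 1 - a + expR a * (cos b - 1).
pose v := expR a * (sin b - b) + (expR a - 1) * b.
have -> : cexp z - 1 - z = u%:C + 'i * v%:C.
  by apply/eqP; rewrite eq_complex /cexp /u /v /=; apply/andP; split; apply/eqP; ring.
have ub : `|u| <= e * `|a| + 2 * (e * `|b|).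
  by rewrite (le_trans (ler_normD _ _)) // lerD // normrM ler_pM.
have vb : `|v| <= 2 * (e * `|b|) + e * `|b|.
  by rewrite (le_trans (ler_normD _ _)) // lerD // normrM ler_pM.
rewrite (le_trans (ler_normD _ _)) // normrM.
have -> : `|'i| = 1 :> R[i] by rewrite normc_def /= expr0n expr1n add0r sqrtr1.
rewrite mul1r.
have nr (x : R) : `|x%:C| = `|x|%:C by rewrite normc_def /= expr0n addr0 sqrtr_sqr.
rewrite !nr.
have : (`|u| + `|v|)%:C <= (e * `|a| + 2 * (e * `|b|) + (2 * (e * `|b|) + e * `|b|))%:C.
  by rewrite lecR lerD.
rewrite (rmorphD _ `|u| `|v|) => /le_trans; apply.
have -> : e * `|a| + 2 * (e * `|b|) + (2 * (e * `|b|) + e * `|b|) = e * (`|a| + 5 * `|b|) by ring.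
have -> : (e * (`|a| + 5 * `|b|))%:C = e%:C * (`|a|%:C + 5%:R * `|b|%:C).
  by rewrite rmorphM rmorphD rmorphM rmorph_nat.
have -> : eps%:C * `|z| = e%:C * (6%:R * `|z|) by rewrite mulrA epsE rmorphM rmorph_nat.
rewrite ler_wpM2l //; first by rewrite ler0c ltW.
have -> : 6%:R * `|z| = `|z| + 5%:R * `|z| by ring.
by rewrite lerD // ler_wpM2l.
Unshelve. all: by end_near.
Qed.

(** Norms and tolerances on [R[i]] are themselves complex; this brings them back to real numbers. *)
Lemma gt0_complex_real (e : R[i]) : 0 < e -> exists2 r : R, 0 < r & e = r%:C.
Proof.
move=> e0; have eE : e = (complex.Re e)%:C by rewrite RRe_real // gtr0_real.
by exists (complex.Re e) => //; rewrite -ltcR -eE.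
Qed.

Lemma norm_complex_real z : exists2 r : R, 0 <= r & `|z| = r%:C.
Proof. by rewrite normc_def; exists (Num.sqrt (complex.Re z ^+ 2 + complex.Im z ^+ 2)); rewrite ?sqrtr_ge0. Qed.

(** By [cexpD] the difference quotient at [s] is [cexp (w * s)] times the one at 0, which
    [cexp_expansion] controls. *)
Lemma derivable_cexpM (w s : R[i]) :
  derivable (fun s : R[i]^o => cexp (w * s) : R[i]^o) s 1.
Proof.
apply/cvg_ex; exists (w * cexp (w * s)); apply/cvgrPdist_le => /= e /gt0_complex_real [r r0 ->].
have [M M0 ME] := norm_complex_real (cexp (w * s)).
have [W W0 WE] := norm_complex_real w.
(* The added 1 keeps the divisors positive when [w = 0]. *)
have M1 : 0 < M * W + 1 by rewrite ltr_wpDl ?mulr_ge0.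
have W1 : 0 < W + 1 by rewrite ltr_wpDl.
have [del d0 H] := cexp_expansion (divr_gt0 r0 M1).
near=> h.
have h0 : h != 0 by near: h; rewrite near_withinE; apply: nearW.
have hd : `|h| < (del / (W + 1))%:C.
  by near: h; apply: (@dnbhs0_lt R[i] R[i]^o); rewrite ltcR divr_gt0.
have wh : `|w * h| < del%:C.
  rewrite normrM WE (@le_lt_trans _ _ ((W + 1)%:C * `|h|)) //.
    by rewrite ler_wpM2r // lecR lerDl.
  by rewrite -ltr_pdivlMl ?ltcR // -rmorphV ?unitfE ?gt_eqF // -rmorphM mulrC.
have {}H := H _ wh.
have -> : w * cexp (w * s) - h^-1 *: (cexp (w * (h *: 1 + s)) - cexp (w * s)) =
  - (cexp (w * s) * (cexp (w * h) - 1 - w * h) / h).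
  have -> : h *: (1 : R[i]^o) = h :> R[i] by rewrite /GRing.scale /= mulr1.
  by rewrite mulrDr cexpD /GRing.scale /=; field.
rewrite normrN normf_div normrM ME ler_pdivrMr ?normr_gt0 //.
apply: le_trans (_ : M%:C * ((r / (M * W + 1))%:C * `|w * h|) <= _).
  by rewrite ler_wpM2l ?ler0c.
rewrite normrM WE !mulrA ler_wpM2r //.
rewrite -!rmorphM lecR mulrAC mulrCA ler_piMr //; first exact: ltW.
by rewrite ler_pdivrMr // mul1r lerDl.
Unshelve. all: by end_near.
Qed.

End ComplexExponential.

(** * L-series whose sums over large degrees vanish *)

Section LValueAtOne.
Local Existing Instance totally_filter.
Variables (R : realType) (F : finFieldType) (chi : {poly F} -> R[i]) (D : nat).
Hypothesis chi_le1 : forall f : {poly F}, `|chi f| <= 1.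
Let X k := \sum_(f : {poly_k.+1 F} | monic_of_degree k f) chi f.
Hypothesis X0 : forall k, (D <= k)%N -> X k = 0.

Let E (s : R[i]) k := cexp (- s * (ln (#|F| ^ k)%N%:R)%:C).
(** By [X0] the series grouped by degree stops at [D], so this finite sum is its continuation. *)
Let Lpoly (s : R[i]) := \sum_(k < D) X k * E s k.

Let q_gt1 : (1 : R) < #|F|%:R.
Proof. by rewrite ltr1n finRing_gt1. Qed.

Let norm_E s k : `|E s k| = (expR (- complex.Re s * ln #|F|%:R) ^+ k)%:C.
Proof.
rewrite norm_cexp; congr (_%:C); rewrite -expRM_natr; congr expR.
rewrite natrX lnXn ?(lt_trans ltr01) // -mulr_natr.
by case: s => a b /=; ring.
Qed.

Let L_termE s k (f : {poly F}) : monic_of_degree k f -> L_term chi s f = chi f * E s k.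
Proof. by case/andP=> mf /eqP sf; rewrite /L_term mf /norm_poly sf. Qed.

Lemma derivable_L_polynomial s : derivable (Lpoly : R[i]^o -> R[i]^o) s 1.
Proof.
have -> : (Lpoly : R[i]^o -> R[i]^o) =
  \sum_(k < D) (X k \*: (fun s : R[i]^o => cexp (- (ln (#|F| ^ k)%N%:R)%:C * s) : R[i]^o)).
  apply/funext => z; rewrite fct_sumE; apply: eq_bigr => k _ /=.
  by rewrite /E mulrC [LHS]mulrC !mulNr [_ * z]mulrC.
apply: derivable_sum => k; apply: derivableZ; exact: derivable_cexpM.
Qed.

Let sum_seq_fset (A : {fset {poly F}}) N (T : {poly F} -> R[i]) :
  (forall f, f \in A -> (size f <= N)%N) ->
  \sum_(f : A) T (val f) = \sum_(f : {poly_N F} | (f : {poly F}) \in A) T f.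
Proof.
move=> AN; rewrite -(big_seq_fsetE _ A xpredT T) /=.
rewrite -[RHS](big_map (fun f : {poly_N F} => f : {poly F}) (fun f => f \in A) T).
rewrite -[RHS]big_filter; apply: perm_big; apply: uniq_perm.
- exact: fset_uniq.
- by rewrite filter_uniq // map_inj_uniq ?index_enum_uniq //; exact: val_inj.
move=> f; rewrite mem_filter; apply/idP/andP => [fA|[]//]; split=> //.
by apply/mapP; exists (npolyp N f); rewrite ?mem_index_enum // npolypK // AN.
Qed.

Let Lpoly_partial s K : (D <= K)%N ->
  Lpoly s = \sum_(f : {poly_K F} | (f : {poly F}) \is monic) L_term chi s f.
Proof.
move=> DK; rewrite sum_monic_by_degree /Lpoly (big_ord_widen K (fun k => X k * E s k)) //.
rewrite big_mkcond; apply: eq_bigr => k _.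
have -> : \sum_(f : {poly_k.+1 F} | monic_of_degree k f) L_term chi s f = X k * E s k.
  by rewrite mulr_suml; apply: eq_bigr => f mf; rewrite (L_termE s mf).
by case: ltnP => // kD; rewrite X0 // mul0r.
Qed.

Let geometric_tail (x : R) K N : 0 <= x < 1 -> (K <= N)%N ->
  \sum_(K <= k < N) x ^+ k <= x ^+ K / (1 - x).
Proof.
move=> /andP[x0 x1] KN; have y0 : 0 < 1 - x by rewrite subr_gt0.
suff -> : \sum_(K <= k < N) x ^+ k = (x ^+ K - x ^+ N) / (1 - x).
  by rewrite ler_pM2r ?invr_gt0 // gerBl exprn_ge0.
elim: N KN => [|N IH]; first by rewrite leqn0 => /eqP ->; rewrite big_geq // subrr mul0r.
rewrite leq_eqVlt ltnS => /predU1P[->|KN]; first by rewrite big_geq // subrr mul0r.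
rewrite big_nat_recr //= IH // exprS.
by move: y0; rewrite lt0r => /andP[y0 _]; field.
Qed.

(** The [q^k] monic polynomials of degree [k] contribute at most [x^k] in norm, where
    [x = q^(1 - Re s) < 1]. Hence a finite set containing every polynomial of degree less than
    [K >= D] misses the limit by at most a geometric tail. *)
Lemma L_series_cvg s : 1 < complex.Re s ->
  (partial_sum (L_term chi s : {poly F} -> R[i]^o) @ totally --> (Lpoly s : R[i]^o))%classic.
Proof.
move=> s1; apply/cvgrPdist_le => /= _ /gt0_complex_real[e e0 ->].
pose rho := expR (- complex.Re s * ln (#|F|%:R : R)).
pose x := #|F|%:R * rho.
have lnq : 0 < ln (#|F|%:R : R) by rewrite ln_gt0.
have xE : x = expR ((1 - complex.Re s) * ln #|F|%:R).
  by rewrite /x /rho mulrBl mul1r -mulNr expRD lnK ?posrE ?(lt_trans ltr01).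
have x01 : 0 <= x < 1.
  by rewrite xE expR_ge0 expR_lt1 pmulr_llt0 // subr_lt0.
have /andP[x0 x1] := x01.
have y0 : 0 < 1 - x by rewrite subr_gt0.
have [K DK xK] : exists2 K, (D <= K)%N & x ^+ K <= e * (1 - x).
  have /cvgrPdist_le /(_ (e * (1 - x))) : (GRing.exp x @ \oo --> 0)%classic.
    by apply: cvg_expr; rewrite ger0_norm.
  rewrite mulr_gt0 // => /(_ isT) [K _ HK]; exists (maxn D K); first exact: leq_maxl.
  have := HK (maxn D K) (leq_maxr _ _).
  by rewrite /= sub0r normrN ger0_norm // exprn_ge0.
exists [fset val f | f in {: {poly_K F}}]%fset => // A /= /fsubsetP sA.
(* [N] also bounds the sizes in [A], so that both sums can be written over [{poly_N F}] and
   subtracted termwise. *)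
pose N := maxn K (\big[maxn/0%N]_(f <- A) size f).
have AN f : f \in A -> (size f <= N)%N.
  move=> fA; rewrite /N (bigD1_seq f) ?fset_uniq //=.
  by rewrite maxnCA leq_maxl.
have KN : (K <= N)%N := leq_maxl _ _.
rewrite /partial_sum (sum_seq_fset _ AN) (@Lpoly_partial s K) //.
rewrite (sum_npoly_widen (fun f => f \is monic) (L_term chi s) KN).
have -> : \sum_(f : {poly_N F} | (f : {poly F}) \in A) L_term chi s f =
  \sum_(f : {poly_N F} | (f : {poly F}) \is monic) (if (f : {poly F}) \in A then L_term chi s f else 0).
  rewrite big_mkcond [RHS]big_mkcond; apply: eq_bigr => f _.
  by rewrite /L_term; case: ifP; case: ifP.
rewrite big_mkcondl /= -sumrB.
pose bound (f : {poly F}) : R[i] := if (size f <= K)%N then 0 else (rho ^+ (size f).-1)%:C.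
apply: le_trans (_ : \sum_(f : {poly_N F} | (f : {poly F}) \is monic) bound f <= _).
  apply: (le_trans (ler_norm_sum _ _ _)); apply: ler_sum => f mf; rewrite /bound.
  have T1 : `|L_term chi s f| <= (rho ^+ (size (f : {poly F})).-1)%:C.
    have fm : monic_of_degree (size (f : {poly F})).-1 f.
      by rewrite /monic_of_degree mf prednK ?eqxx // lt0n size_poly_eq0 monic_neq0.
    by rewrite (L_termE s fm) normrM norm_E ler_piMl ?chi_le1 // ler0c exprn_ge0 ?expR_ge0.
  case: (leqP (size (f : {poly F})) K) => sf.
    have -> : (f : {poly F}) \in A.
      by apply: sA; apply/imfsetP; exists (npolyp K f) => //=; rewrite npolypK.
    by rewrite subrr normr0.
  by rewrite sub0r normrN; case: ifP => _ //; rewrite normr0 ler0c exprn_ge0 ?expR_ge0.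
rewrite sum_monic_by_degree.
have -> : \sum_(k < N) \sum_(f : {poly_k.+1 F} | monic_of_degree k f) bound f =
   (\sum_(K <= k < N) x ^+ k)%:C.
  rewrite (big_nat_widenl _ 0) // big_mkord rmorph_sum /= [RHS]big_mkcond /=.
  apply: eq_bigr => k _.
  rewrite (eq_bigr (fun=> if (k.+1 <= K)%N then 0 else (rho ^+ k)%:C)); last first.
    by move=> f /andP[_ /eqP sf]; rewrite /bound sf.
  rewrite sum_monic_const ltnNge; case: leqP => _ /=; last by rewrite mul0rn.
  by rewrite -rmorphMn /= -mulr_natl natrX exprMn.
rewrite lecR (le_trans (geometric_tail x01 KN)) // ler_pdivrMr //.
Qed.

(* [1] is on the boundary of the half-plane [Re s > 1], so that continuity at [1]
   is enough to identify the value there of any continuation. *)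
Lemma L_function1 : L_function chi 1 = \sum_(k < D) X k / (#|F| ^ k)%N%:R.
Proof.
have LP : continues_L_series chi Lpoly.
  by split; [exact: derivable_L_polynomial|exact: L_series_cvg].
have [dL sL] : continues_L_series chi (L_function chi).
  by apply: (@xgetPex _ (fun=> 0) [set Lam | continues_L_series chi Lam]%classic); exists Lpoly.
have agree s : 1 < complex.Re s -> L_function chi s = Lpoly s.
  move=> s1; apply: (cvg_unique (@norm_hausdorff R[i] R[i]^o) (sL s s1)); exact: L_series_cvg.
have cont (G : R[i]^o -> R[i]^o) : (forall s, derivable G s 1) -> {for (1 : R[i]^o), continuous G}.
  by move=> dG; apply: differentiable_continuous; apply/derivable1_diffP; exact: dG.
have -> : L_function chi 1 = Lpoly 1.
  apply/eqP; rewrite -subr_eq0 -normr_le0; apply/ler_addgt0Pl => _ /gt0_complex_real[e e0 ->].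
  have e2 : (0 : R[i]) < (e / 2)%:C by rewrite ltcR divr_gt0.
  have /cvgrPdist_le /(_ _ e2) := cont _ dL.
  have /cvgrPdist_le /(_ _ e2) := cont _ derivable_L_polynomial.
  move=> /nbhs_ballP[_ /= /gt0_complex_real[d1 d10 ->] H1] /nbhs_ballP[_ /= /gt0_complex_real[d2 d20 ->] H2].
  (* The point [1 + d] lies in both neighbourhoods of 1 and in the half-plane where the two
     functions agree. *)
  pose d := Num.min d1 d2 / 2; have d0 : 0 < d by rewrite divr_gt0 // lt_min d10.
  have dm : d < Num.min d1 d2 by rewrite ltr_pdivrMr // ltr_pMr ?ltr1n // lt_min d10.
  move: dm; rewrite lt_min => /andP[dd1 dd2].
  pose s : R[i] := 1 + d%:C.
  have sd : `|1 - s| = d%:C.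
    by rewrite /s opprD addrA subrr sub0r normrN ger0_norm // ler0c ltW.
  have := H1 s; rewrite /ball /= sd ltcR => /(_ dd1) h1.
  have := H2 s; rewrite /ball /= sd ltcR => /(_ dd2) h2.
  have s1 : 1 < complex.Re s by rewrite /= ltrDl.
  rewrite addr0; have -> : e%:C = (e / 2)%:C + (e / 2)%:C by rewrite -rmorphD /= -splitr.
  rewrite (_ : L_function chi 1 - Lpoly 1 =
     (L_function chi 1 - L_function chi s) - (Lpoly 1 - Lpoly s)); last first.
    by rewrite (agree s s1); ring.
  by rewrite (le_trans (ler_normB _ _)) // lerD.
apply: eq_bigr => k _; congr (_ * _).
rewrite /E mulN1r -rmorphN cexp_real /= expRN lnK.
  by rewrite fmorphV rmorph_nat.
by rewrite posrE ltr0n expn_gt0 (ltn_trans _ (finRing_gt1 F)).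
Qed.

End LValueAtOne.

(** * Additive characters *)

(** Distinct automorphisms are linearly independent, so their sum, with all coefficients 1, is not
    zero. *)
Lemma galTrace_nontrivial (F0 : fieldType) (L : splittingFieldType F0) (U E : {subfield L}) :
  exists2 y, y \in E & galTrace U E y != 0.
Proof.
have [y yE ty] := @gal_independent_contra F0 L E (fun s => s \in 'Gal(E / U)%g) (fun=> 1)
  1%g (group1 _) (oner_neq0 _).
exists y => //; apply: contra_neq ty => t0; rewrite -[RHS]t0.
by apply: eq_bigr => s _; rewrite mul1r.
Qed.

(** Permuting the terms by [u] multiplies the sum by [c]. The orthogonality relations for additive
    characters all reduce to this. *)
Lemma sum_eigen_eq0 (I : finType) (A : idomainType) (E : I -> A) (u : I -> I) (c : A) :
  injective u -> (forall i, E (u i) = c * E i) -> c != 1 -> \sum_i E i = 0.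
Proof.
move=> u_inj Eu c1; apply/eqP.
have : (1 - c) * (\sum_i E i) = 0.
  rewrite mulrBl mul1r; apply/eqP; rewrite subr_eq0; apply/eqP.
  by rewrite [LHS](reindex_inj u_inj) mulr_sumr; apply: eq_bigr => i _; rewrite Eu.
by move/eqP; rewrite mulf_eq0 subr_eq0 eq_sym (negPf c1).
Qed.

Section AdditiveCharacter.
Variables (R : realType) (p : nat) (F : finFieldType).
Hypothesis pcharF : p \in [pchar F].
Implicit Types (x y : F) (a b f g h r : {poly F}).

Local Notation K := (pPrimeCharType pcharF).
Local Notation tr := (absolute_trace pcharF).
Local Notation psi := (e_q R pcharF).

Let p_prime : prime p := pcharf_prime pcharF.

Lemma absolute_traceD x y : tr (x + y) = tr x + tr y.
Proof.
apply: (fmorph_inj (in_alg K)); rewrite rmorphD /= !absolute_traceP.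
exact: raddfD.
Qed.

Lemma absolute_trace_nontrivial : exists y, tr y != 0.
Proof.
have [y _ ty] := galTrace_nontrivial 1%AS {:K}%AS.
exists y; apply: contra_neq ty => ty0.
by rewrite -absolute_traceP ty0 scale0r.
Qed.

Let zeta : R[i] := cexp ('i * (2 * pi / p%:R)%:C).

Let e_q_zeta y : psi y = zeta ^+ (tr y).
Proof.
rewrite /e_q -cexp_natM; congr cexp; rewrite mulrCA; congr (_ * _).
by rewrite -[in RHS](rmorph_nat (real_complex R)) -rmorphM /=; congr (_%:C); ring.
Qed.

Let p_neq0 : (p%:R : R) != 0.
Proof. by rewrite pnatr_eq0 -lt0n prime_gt0. Qed.

Let zeta_p : zeta ^+ p = 1.
Proof.
rewrite -cexp_natM -[p%:R](rmorph_nat (real_complex R)) mulrCA -rmorphM /=.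
rewrite (_ : p%:R * (2 * pi / p%:R) = 2 * pi); last by field.
rewrite /cexp /= !(mul0r, mul1r, mulr0, oppr0, subr0, addr0, add0r, expR0).
by rewrite mulr_natl cos2pi sin2pi.
Qed.

(** The real part is [cos (2 y) = 1 - 2 (sin y)^2] with [y = k pi / p] strictly between 0 and
    [pi]. *)
Let zeta_neq1 k : (0 < k < p)%N -> zeta ^+ k != 1.
Proof.
move=> /andP[k0 kp]; apply/eqP; rewrite -cexp_natM -[k%:R](rmorph_nat (real_complex R)).
rewrite mulrCA -rmorphM /=; set x := k%:R * _.
rewrite /cexp /= !(mul0r, mul1r, mulr0, oppr0, subr0, addr0, add0r, expR0) => /(congr1 (@complex.Re R)) /=.
pose y : R := k%:R * pi / p%:R.
have -> : x = y *+ 2 by rewrite /x /y mulr2n; field.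
have : 0 < sin y.
  apply: sin_gt0_pi; rewrite /y divr_gt0 ?mulr_gt0 ?pi_gt0 ?ltr0n ?(prime_gt0 p_prime) //=.
  by rewrite ltr_pdivrMr ?ltr0n ?prime_gt0 // mulrC ltr_pM2l ?pi_gt0 // ltr_nat.
move=> s0; rewrite cos_mulr2n cos2sin2 => c1.
have : sin y ^+ 2 = 0 by move: c1; rewrite mulr2n; lra.
by move/eqP; rewrite sqrf_eq0 gt_eqF.
Qed.

Lemma e_qD x y : psi (x + y) = psi x * psi y.
Proof.
rewrite !e_q_zeta -exprD absolute_traceD -[RHS](expr_mod _ zeta_p); congr (_ ^+ _).
by rewrite /=; congr (_ %% _)%N; exact: Fp_cast.
Qed.

Lemma e_q0 : psi 0 = 1.
Proof.
have t0 : tr 0 = 0.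
  by apply: (addrI (tr 0)); rewrite -absolute_traceD !addr0.
by rewrite e_q_zeta t0 expr0.
Qed.

Lemma e_q_nontrivial : exists y, psi y != 1.
Proof.
have [y ty] := absolute_trace_nontrivial; exists y.
rewrite e_q_zeta zeta_neq1 // lt0n; apply/andP; split.
  by apply: contra_neq ty => t0; apply: val_inj.
by have := ltn_ord (tr y); rewrite [X in (_ < X)%N]Fp_cast.
Qed.

Lemma sum_e_q_mulr (c : F) : \sum_y psi (y * c) = if c == 0 then #|F|%:R else 0.
Proof.
have [->|c0] := eqVneq c 0.
  by under eq_bigr do rewrite mulr0 e_q0; rewrite sumr_const.
have [y ey] := e_q_nontrivial.
apply: (sum_eigen_eq0 (addrI (y / c)) _ ey) => z.
by rewrite mulrDl e_qD divfK.
Qed.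

Lemma sum_e_q_mulr_neq0 (c : F) :
  \sum_(y | y != 0) psi (y * c) = (if c == 0 then #|F|%:R else 0) - 1.
Proof.
by rewrite -(sum_e_q_mulr c) [in RHS](bigD1 0) //= mul0r e_q0 addrAC subrr add0r.
Qed.

(** * The additive character on fractions with denominator [g] *)

Section Fractions.
Variables (g : {poly F}) (m : nat).
Hypotheses (g_monic : g \is monic) (size_g : size g = m.+2).

Let g0 : g != 0. Proof. exact: monic_neq0. Qed.

(** As [g] is monic of degree [m + 1], subtracting [r_m g] from [T r] leaves a remainder [h] of
    degree less than [deg g]. So [r_m] is the constant term of the polynomial part of [T a / g]. *)
Lemma e_fracE a : e_frac R pcharF a g = psi ((a %% g)`_m).
Proof.
rewrite /e_frac /e_laurent; congr psi; rewrite /= expr1.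
set r := a %% g; pose h := 'X * r - r`_m *: g.
have sr : (size r <= m.+1)%N by rewrite -ltnS -size_g ltn_modp.
have sh : (size h < size g)%N.
  rewrite size_g ltnS; apply/leq_sizeP => j jm.
  rewrite /h coefB coefXM coefZ; case: j jm => [//|j]; rewrite ltnS /= => jm.
  move: jm; rewrite leq_eqVlt => /predU1P[<-|jm].
    by have := monicP g_monic; rewrite /lead_coef size_g /= => ->; rewrite mulr1 subrr.
  rewrite (nth_default _ (leq_trans sr jm)) [g`_j.+1]nth_default ?size_g //.
  by rewrite mulr0 subrr.
have -> : 'X * a = ('X * (a %/ g) + (r`_m)%:P) * g + h.
  by rewrite {1}(divp_eq a g) -/r /h -mul_polyC; ring.
by rewrite divpD mulpK // (divp_small sh) addr0 coefD coefXM coefC /= add0r.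
Qed.

Lemma e_frac_mod a : e_frac R pcharF (a %% g) g = e_frac R pcharF a g.
Proof. by rewrite !e_fracE modp_id. Qed.

Lemma e_fracD a b : e_frac R pcharF (a + b) g = e_frac R pcharF a g * e_frac R pcharF b g.
Proof. by rewrite !e_fracE modpD coefD e_qD. Qed.

(** Once [T^j] is split off, the rest of [h] runs over an additive group on which [e (b h / g)] is a
    character. It is trivial exactly when the residue of [b] has degree at most [m - j], and [T^j]
    then picks the coefficient of [T^(m - j)]. For [j > m] the truncated bound says that the residue
    is 0. *)
Lemma sum_monic_e_frac b j :
  \sum_(h : {poly_j.+1 F} | monic_of_degree j h) e_frac R pcharF (b * (h : {poly F})) g =
  if (size (b %% g)%R <= m.+1 - j)%N then (#|F| ^ j)%:R * psi (b %% g)`_(m - j) else 0.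
Proof.
rewrite (sum_monic_shift _ (fun h => e_frac R pcharF (b * h) g)).
under eq_bigr do rewrite mulrDr e_fracD; rewrite -mulr_sumr.
have bh h : e_frac R pcharF (b * h) g = e_frac R pcharF (b %% g * h) g.
  by rewrite -e_frac_mod -[RHS]e_frac_mod ![_ * h]mulrC modp_mul.
under eq_bigr do rewrite bh; rewrite bh; set r := b %% g.
have sr : (size r <= m.+1)%N by rewrite -ltnS -size_g ltn_modp.
have small a : (size a <= m.+1)%N -> e_frac R pcharF a g = psi a`_m.
  by move=> sa; rewrite e_fracE modp_small // size_g.
case: leqP => sj.
  have [r0|r0] := eqVneq r 0.
    under eq_bigr do rewrite r0 mul0r small ?size_poly0 // coef0 e_q0.
    by rewrite sum_npoly_const r0 mul0r small ?size_poly0 // !coef0 e_q0 mul1r mulr1.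
  have s0 : (0 < size r)%N by rewrite lt0n size_poly_eq0.
  have jm : (j <= m)%N by lia.
  rewrite mulrC; congr (_ * _).
    rewrite (eq_bigr (fun=> 1)) ?sum_npoly_const // => h _.
    have shr : (size (r * (h : {poly F}))%R <= m)%N.
      apply: leq_trans (size_polyMleq _ _) _; have := size_npoly h; move: sj s0.
      by move: (size r) (size h) => u v; lia.
    by rewrite small ?nth_default ?e_q0 // leqW.
  rewrite small ?coefMXn ?ltnNge ?jm // (leq_trans (size_polyMleq _ _)) // size_polyXn.
  by move: sj s0 jm; move: (size r) => u; lia.
have r0 : r != 0 by apply: contraTneq sj => ->; rewrite size_poly0.
rewrite [X in _ * X](_ : _ = 0) ?mulr0 //.
have [y ey] := e_q_nontrivial.
(* [v] makes [r v] have degree [m] and leading coefficient [y], so that translation by [v]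
   multiplies the terms by [psi y]. *)
pose v : {poly F} := (y / lead_coef r) *: 'X^(m.+1 - size r).
have sv : (size v <= j)%N.
  by rewrite (leq_trans (size_scale_leq _ _)) // size_polyXn; lia.
apply: (sum_eigen_eq0 (addrI (npolyp j v)) _ ey) => h.
rewrite /= mulrDr e_fracD; congr (_ * _).
rewrite npolypK // /v -scalerAr small; last first.
  by rewrite (leq_trans (size_scale_leq _ _)) // size_mulXn // subnK.
rewrite coefZ coefMXn.
have s0 : (0 < size r)%N by rewrite lt0n size_poly_eq0.
have -> : (m < m.+1 - size r)%N = false by lia.
have -> : (m - (m.+1 - size r))%N = (size r).-1 by lia.
by rewrite divfK // lead_coef_eq0.
Qed.

End Fractions.

End AdditiveCharacter.

(** * Residues and Dirichlet characters *)

Section Residues.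
Variable F : finFieldType.
Implicit Types (a b c f g h l r s : {poly F}).

Lemma coprimep_inverse a l : coprimep a l -> exists b, l %| a * b - 1.
Proof.
move/Bezout_eq1_coprimepP => [[u v] /= uv]; exists u.
by rewrite -uv mulrC opprD addNKr dvdpNr dvdp_mull.
Qed.

Lemma inverse_coprimep a b l : l %| a * b - 1 -> coprimep a l.
Proof.
case/dvdpP => v abv; apply/Bezout_eq1_coprimepP; exists (b, - v) => /=.
by rewrite mulNr -abv mulrC subKr.
Qed.

Lemma modp_eqE g a b : g != 0 -> (g %| a - b) = (a %% g == b %% g).
Proof. by move=> g0; rewrite /dvdp modpD modpN subr_eq0. Qed.

(** This symmetry lets the same pairs be enumerated from either variable. *)
Lemma dvdp_inverse_swap g c c' (cc' : g %| c * c' - 1) a r :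
  (g %| a - c * r) = (g %| r - c' * a).
Proof.
apply/idP/idP => h.
  rewrite (_ : _ - _ = - ((c * c' - 1) * r + c' * (a - c * r))); last by ring.
  by rewrite dvdpNr; apply: dvdp_add; [exact: dvdp_mulr|exact: dvdp_mull].
rewrite (_ : _ - _ = - ((c * c' - 1) * a + c * (r - c' * a))); last by ring.
by rewrite dvdpNr; apply: dvdp_add; [exact: dvdp_mulr|exact: dvdp_mull].
Qed.

Lemma sum_residues_mul (V : nmodType) D l a b (E : {poly F} -> V) :
  size l = D.+1 -> l %| a * b - 1 ->
  \sum_(r : {poly_D F}) E ((r : {poly F}) * a %% l) = \sum_(r : {poly_D F}) E r.
Proof.
move=> sl ab; have l0 : l != 0 by rewrite -size_poly_eq0 sl.
have sm f : (size (f %% l)%R <= D)%N by rewrite -ltnS -sl ltn_modp.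
have inv f c d : l %| c * d - 1 -> (size f <= D)%N -> ((f * c %% l) * d) %% l = f.
  rewrite modp_eqE // => /eqP cd sf.
  rewrite mulrC modp_mul mulrC -mulrA -modp_mul cd modp_mul mulr1.
  by rewrite modp_small // sl.
symmetry; apply: (@sum_npoly_reindex _ _ D D predT predT
   (fun f => f * a %% l) (fun f => f * b %% l)) => f sf _; split=> //; apply: inv => //.
by rewrite mulrC.
Qed.

(** The [h] giving the residue [r] are [w g + ((r - s) mod g)] with [w] arbitrary of size at most
    [t - m]. *)
Lemma sum_equidistributed (V : nmodType) m t g s (E : {poly F} -> V) :
  size g = m.+1 -> (m <= t)%N ->
  \sum_(h : {poly_t F}) E ((s + (h : {poly F})) %% g) =
  (\sum_(r : {poly_m F}) E r) *+ #|F| ^ (t - m).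
Proof.
move=> sg mt; have g0 : g != 0 by rewrite -size_poly_eq0 sg.
have sm f : (size (f %% g)%R <= m)%N by rewrite -ltnS -sg ltn_modp.
rewrite (partition_big (fun h : {poly_t F} => npolyp m ((s + (h : {poly F})) %% g)) xpredT) //=.
rewrite -sumrMnl; apply: eq_bigr => r _.
transitivity (\sum_(h : {poly_t F} | (s + (h : {poly F})) %% g == r) E r).
  apply: eq_big => [h|h /eqP <-]; last by rewrite npolypK.
  by rewrite -(inj_eq val_inj) /= npolypK.
rewrite -(sum_npoly_const F (t - m)).
have sr : r %% g = r :> {poly F} by rewrite modp_small // sg ltnS size_npoly.
move: (r : {poly F}) sr => {}r sr.
rewrite (@sum_npoly_reindex F V (t - m) t predT (fun h => (s + h) %% g == r)
   (fun w => w * g + (r - s) %% g) (fun h => h %/ g) (fun=> E r)) // => f sf.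
- move=> _; split.
  + rewrite (leq_trans (size_polyD _ _)) // geq_max (leq_trans (sm _) mt) andbT.
    rewrite (leq_trans (size_polyMleq _ _)) // sg addnS /=.
    by rewrite addnC -leq_subRL.
  + by rewrite modpD modpD modp_mull add0r modp_id -modpD addrCA subrr addr0 sr.
  + by rewrite divpD mulpK // divp_small ?addr0 // sg ltnS.
- move=> /eqP sfr; split=> //; first by rewrite size_divp // sg leq_sub2r.
  rewrite [RHS](divp_eq f g) -sfr; congr (_ + _).
  by rewrite modpD modp_id -modpD addrAC subrr add0r.
Qed.

End Residues.

(** * Values and complete sums of Dirichlet characters *)

Section DirichletCharacters.
Variables (R : realType) (F : finFieldType) (l : {poly F}) (D : nat) (chi : {poly F} -> R[i]).
Implicit Types (a b d f : {poly F}).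
Hypotheses (chiP : dirichlet_character l chi) (size_l : size l = D.+1).

Let l_neq0 : l != 0. Proof. by rewrite -size_poly_eq0 size_l. Qed.

Lemma character_mod a : chi (a %% l) = chi a.
Proof. by apply: (character_periodic chiP); rewrite modp_eqE // modp_id. Qed.

Lemma character_neq0 a : coprimep a l -> chi a != 0.
Proof. by rewrite (character_support chiP). Qed.

Lemma character_eq0 a : ~~ coprimep a l -> chi a = 0.
Proof. by rewrite -(character_support chiP) negbK => /eqP. Qed.

Lemma character_inverse a b : l %| a * b - 1 -> chi a * chi b = 1.
Proof.
by move=> ab; rewrite -(character_mul chiP) (character_periodic chiP ab) (character_one chiP).
Qed.

(* Multiplication by [a] permutes the residues, so [sum_r |chi r|] equals [|chi a|] times itself. *)
Lemma norm_character a : coprimep a l -> `|chi a| = 1.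
Proof.
move=> /coprimep_inverse[b ab].
have := sum_residues_mul (fun r => `|chi r|) size_l ab.
under eq_bigr do rewrite character_mod (character_mul chiP) normrM mulrC.
rewrite -mulr_sumr => /eqP; set S := \sum_(r : _) _.
have S0 : S != 0.
  rewrite psumr_neq0 //; apply/hasP; exists (npolyp D (1 %% l)); first exact: mem_index_enum.
  have s1 : (size (1 %% l)%R <= D)%N by rewrite -ltnS -size_l ltn_modp.
  by rewrite /= npolypK // character_mod (character_one chiP) normr1 ltr01.
by rewrite -subr_eq0 -[X in _ - X]mul1r -mulrBl mulf_eq0 (negPf S0) orbF subr_eq0 => /eqP.
Qed.

Lemma norm_character_le1 a : `|chi a| <= 1.
Proof.
have [/norm_character -> //|/character_eq0 ->] := boolP (coprimep a l).
by rewrite normr0 ler01.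
Qed.

Lemma mul_conj_character a : coprimep a l -> chi a * conj_character chi a = 1.
Proof. by rewrite /conj_character; move=> /norm_character a1; rewrite -sqr_normc a1 expr1n. Qed.

Lemma conj_character_inverse a b : l %| a * b - 1 -> conj_character chi a = chi b.
Proof.
move=> ab; have ca := inverse_coprimep ab.
by apply: (mulfI (character_neq0 ca)); rewrite mul_conj_character // character_inverse.
Qed.

Lemma sum_character_residues a : coprimep a l -> chi a != 1 ->
  \sum_(r : {poly_D F}) chi r = 0.
Proof.
move=> /coprimep_inverse[b ab] ca.
have := sum_residues_mul chi size_l ab.
under eq_bigr do rewrite character_mod (character_mul chiP) mulrC.
rewrite -mulr_sumr => /eqP; rewrite -subr_eq0 -[X in _ - X]mul1r -mulrBl mulf_eq0 subr_eq0.
by rewrite (negPf ca) => /eqP.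
Qed.

(** Applied with [s = T^t] for monic polynomials, and with [s = z T^t] when a coefficient is
    fixed. *)
Lemma sum_character_shift a t s : coprimep a l -> chi a != 1 -> (D <= t)%N ->
  \sum_(h : {poly_t F}) chi (s + (h : {poly F})) = 0.
Proof.
move=> ca ca1 Dt.
under eq_bigr do rewrite -character_mod.
by rewrite (sum_equidistributed _ _ size_l Dt) (sum_character_residues ca) // mul0rn.
Qed.

End DirichletCharacters.

Lemma conj_dirichlet_character (R : realType) (F : finFieldType) (l : {poly F})
    (chi : {poly F} -> R[i]) :
  dirichlet_character l chi -> dirichlet_character l (conj_character chi).
Proof.
case=> per one mul supp; rewrite /conj_character; split=> [a b /per -> //||a b|a].
- by rewrite one conjc1.
- by rewrite mul rmorphM.
- by rewrite conjc_eq0.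
Qed.

(** * Primitive characters and their Gauss sums *)

Section PrimitiveCharacters.
Variables (R : realType) (F : finFieldType) (l : {poly F}) (D : nat) (chi : {poly F} -> R[i]).
Implicit Types (a b d f : {poly F}).
Hypotheses (primP : primitive_character l chi) (size_l : size l = D.+1) (l_monic : l \is monic).

Let chiP : dirichlet_character l chi. Proof. by case: primP. Qed.
Let l_neq0 : l != 0. Proof. exact: monic_neq0. Qed.

(* Adding to [a] the multiple [gcdop a l * d] of [d] makes it prime to [l]: a
   prime factor of [l] divides exactly one of the two terms. *)
Lemma coprimep_lift d a : d %| l -> coprimep a d -> coprimep (a + gdcop a l * d) l.
Proof.
move=> dl cad; rewrite coprimep_sym coprimep_def.
case: gdcopP => k kl; rewrite (negPf l_neq0) orbF => cka kmax.
set e := gcdp _ _; have el : e %| l := dvdp_gcdl _ _.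
have es : e %| a + k * d := dvdp_gcdr _ _.
suff cea : coprimep e a.
  have ek : e %| k by apply: kmax.
  have ea : e %| a by rewrite -(dvdp_addl _ (dvdp_mulr d ek)).
  by move: cea; rewrite coprimep_def (eqp_size (dvdp_gcd_idl ea)).
rewrite coprimep_def; set e' := gcdp e a.
have e'a : e' %| a := dvdp_gcdr _ _.
have e'kd : e' %| k * d by rewrite -(dvdp_addr _ e'a) (dvdp_trans (dvdp_gcdl _ _)).
have ce'k : coprimep e' k by apply: (coprimep_dvdr e'a); rewrite coprimep_sym.
have ce'd : coprimep e' d by apply: (coprimep_dvdr e'a).
rewrite Gauss_dvdpr // in e'kd.
by move: ce'd; rewrite coprimep_def (eqp_size (dvdp_gcd_idl e'kd)).
Qed.

(** Without such an [a], the value of [chi] at a polynomial prime to [l] would depend only on its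
    class modulo [d]. Then [chi] would be induced from [d], against primitivity. *)
Lemma primitive_witness d : d \is monic -> d %| l -> d != l ->
  exists a, [/\ d %| a - 1, coprimep a l & chi a != 1].
Proof.
move=> d_monic dl; apply: contra_neqP => no_witness.
have d0 : d != 0 by exact: monic_neq0.
have triv a : d %| a - 1 -> coprimep a l -> chi a = 1.
  by move=> da cal; apply/eqP/negPn/negP => ca; apply: no_witness; exists a.
have chi_eq a b : d %| a - b -> coprimep a l -> coprimep b l -> chi a = chi b.
  move=> ab cal cbl; have [b' bb'] := coprimep_inverse cbl.
  have cb'l : coprimep b' l by apply: (@inverse_coprimep _ _ b); rewrite mulrC.
  have : chi (a * b') = 1.
    apply: triv; last by rewrite coprimepMl cal.
    rewrite (_ : a * b' - 1 = (a - b) * b' + (b * b' - 1)); last by ring.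
    by rewrite dvdp_add ?dvdp_mulr // (dvdp_trans dl).
  rewrite (character_mul chiP) -(character_inverse chiP bb').
  by move/mulIf; apply; apply: (character_neq0 chiP).
pose lift a := a + gdcop a l * d.
have lift_mod a : d %| lift a - a by rewrite /lift addrAC subrr add0r dvdp_mull.
have lift_cop a : coprimep a d -> coprimep (lift a) l by move/(coprimep_lift dl).
have cop_mod a b : d %| a - b -> coprimep a d = coprimep b d.
  by rewrite modp_eqE // => /eqP ab; rewrite -coprimep_modl ab coprimep_modl.
case: primP => _ /(_ d d_monic dl); apply.
(* By [chi_eq] the value does not depend on the lift, which gives periodicity and multiplicativity
   although [lift] is not multiplicative. *)
exists (fun a => if coprimep a d then chi (lift a) else 0); last first.
  move=> a cal; have cad : coprimep a d := coprimep_dvdl dl cal.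
  by rewrite cad; apply: chi_eq; rewrite ?lift_cop // -opprB dvdpNr.
split=> [a b ab||a b|a].
- rewrite (cop_mod _ _ ab); case: ifP => // cbd; apply: chi_eq; rewrite ?lift_cop //.
    rewrite (_ : lift a - lift b = (lift a - a) + (a - b) - (lift b - b)); last by ring.
    by rewrite dvdp_sub // dvdp_add.
  by rewrite (cop_mod _ _ ab).
- rewrite coprime1p; apply: triv; rewrite ?lift_cop //; exact: coprime1p.
- rewrite coprimepMl; case: (boolP (coprimep a d)) => ca; last by rewrite mul0r.
  case: (boolP (coprimep b d)) => cb; last by rewrite mulr0.
  rewrite -(character_mul chiP); apply: chi_eq; rewrite ?coprimepMl ?lift_cop ?coprimepMl ?ca //.
  rewrite (_ : lift (a * b) - lift a * lift b =
    (lift (a * b) - a * b) - ((lift a - a) * lift b + a * (lift b - b))); last by ring.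
  by apply: dvdp_sub => //; apply: dvdp_add; [exact: dvdp_mulr|exact: dvdp_mull].
- by case: ifP => ca; rewrite ?eqxx // (character_support chiP) lift_cop.
Qed.

Section GaussSums.
Variables (p : nat) (pcharF : p \in [pchar F]).
Local Notation psi := (e_q R pcharF).

(** For [f] prime to [l], substitute [r = a f]. Otherwise the right-hand side is 0, and primitivity
    makes the left-hand side vanish. *)
Lemma gauss_sum_twist f : (0 < D)%N ->
  \sum_(a : {poly_D F}) chi a * e_frac R pcharF ((a : {poly F}) * f) l =
  conj_character chi f * gauss_sum pcharF l chi.
Proof.
move: size_l; case: D => [//|m] sl _; rewrite /gauss_sum sl.
have fmod a : e_frac R pcharF (a %% l) l = e_frac R pcharF a l by exact: (e_frac_mod R pcharF l_monic sl).
have chimod := character_mod chiP sl.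
case: (boolP (coprimep f l)) => [cf|ncf].
  have [f' ff'] := coprimep_inverse cf.
  rewrite (conj_character_inverse chiP sl ff') mulr_sumr.
  rewrite -(sum_residues_mul (fun r => chi f' * (chi r * e_frac R pcharF r l)) sl ff').
  apply: eq_bigr => a _; rewrite fmod chimod mulrA -(character_mul chiP); congr (_ * _).
  apply: (character_periodic chiP).
  rewrite (_ : _ - _ = (a : {poly F}) * (1 - f * f')); last by ring.
  by rewrite dvdp_mull // -opprB dvdpNr.
(* [f] shares the factor [e'] with [l], so that [a -> e (a f / l)] only depends on [a]
   modulo [d = l / e'], whereas [chi] is nontrivial on the residues that are 1 modulo [d]. *)
rewrite [conj_character _ _]/conj_character (character_eq0 chiP ncf) conjc0 mul0r.
pose e := gcdp f l; have e0 : e != 0 by rewrite gcdp_eq0 negb_and l_neq0 orbT.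
(* Normalizing the gcd makes its cofactor [d] monic, as [primitive_witness] requires. *)
pose e' := (lead_coef e)^-1 *: e.
have e'l : e' %| l by rewrite dvdpZl ?invr_eq0 ?lead_coef_eq0 // dvdp_gcdr.
have e'f : e' %| f by rewrite dvdpZl ?invr_eq0 ?lead_coef_eq0 // dvdp_gcdl.
have [d lE] : exists d, l = d * e' by exists (l %/ e'); rewrite divpK.
have d_monic : d \is monic.
  have := l_monic; rewrite {1}lE !monicE lead_coefM lead_coefZ mulVf ?lead_coef_eq0 //.
  by rewrite mulr1.
have dl : d %| l by rewrite lE dvdp_mulr.
have dnl : d != l.
  apply: contraNneq ncf => dE; rewrite coprimep_def -/e.
  have : size l = (size l + size e').-1.
    by rewrite {1}lE size_mul ?dE // ?scaler_eq0 ?invr_eq0 ?lead_coef_eq0 ?(negPf e0).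
  rewrite /e' size_scale ?invr_eq0 ?lead_coef_eq0 // sl addSn => /= [].
  by move/eqP; rewrite -[X in X == _]addn1 eqn_add2l eq_sym => /eqP ->.
have [a0 [da0 ca0 chia0]] := primitive_witness d_monic dl dnl.
have [b0 ab0] := coprimep_inverse ca0.
(* Multiplication by [a0] permutes the residues and scales [chi] by [chi a0], but preserves
   [e (a f / l)] because [l = d e'] divides [(a0 - 1) f]. *)
have := sum_residues_mul (fun r => chi r * e_frac R pcharF (r * f) l) sl ab0.
have step (a : {poly F}) : chi (a * a0 %% l) * e_frac R pcharF (a * a0 %% l * f) l =
  chi a0 * (chi a * e_frac R pcharF (a * f) l).
  have E : (a * a0 %% l * f) %% l = (a * f) %% l.
    apply/eqP; rewrite -modp_eqE //.
    rewrite (_ : _ - _ = (a * a0 %% l - a * a0) * f + a * ((a0 - 1) * f)); last by ring.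
    apply: dvdp_add; first by apply: dvdp_mulr; rewrite modp_eqE // modp_id.
    by apply: dvdp_mull; rewrite lE dvdp_mul.
  by rewrite chimod (character_mul chiP) -fmod E fmod mulrA [chi a0 * _]mulrC.
under eq_bigr do rewrite step.
rewrite -mulr_sumr => /eqP; rewrite -subr_eq0 -[X in _ - X]mul1r -mulrBl mulf_eq0 subr_eq0.
by rewrite (negPf chia0) => /eqP.
Qed.

Lemma nonprincipal_witness : (0 < D)%N -> exists2 a, coprimep a l & chi a != 1.
Proof.
move=> D0; have [|a [_ ca ca1]] := @primitive_witness 1 (monic1 _) (dvd1p _); last by exists a.
by apply: contraTneq D0 => l1; move: size_l; rewrite -l1 size_poly1 => -[<-].
Qed.

(** The sum [U_t]; an [a] of degree less than [t] counts with weight [psi 0 = 1]. *)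
Definition leading_coef_sum t : R[i] := \sum_(a : {poly_t.+1 F}) chi a * psi (a : {poly F})`_t.

(** With the coefficient of [T^t] fixed, the weight is constant and the lower coefficients cover
    every residue modulo [l] equally often. *)
Lemma leading_coef_sum_eq0 t : (0 < D)%N -> (D <= t)%N -> leading_coef_sum t = 0.
Proof.
move=> /nonprincipal_witness[w cw cw1] Dt.
rewrite /leading_coef_sum (partition_big (fun a : {poly_t.+1 F} => (a : {poly F})`_t) xpredT) //=.
rewrite big1 // => z _.
pose u (h : {poly F}) := z *: 'X^t + h.
rewrite (@sum_npoly_reindex F _ t t.+1 predT (fun a => a`_t == z) u (fun a => a - z *: 'X^t)
  (fun a => chi a * psi a`_t)) => [|h sh _|a sa /eqP az].
- transitivity (\sum_(h : {poly_t F}) chi (z *: 'X^t + (h : {poly F})) * psi z).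
    apply: eq_bigr => h _; rewrite /u coefD coefZ coefXn eqxx mulr1.
    by rewrite [(h : {poly F})`_t]nth_default ?addr0 ?size_npoly.
  by rewrite -mulr_suml (sum_character_shift chiP size_l _ cw cw1) // mul0r.
- rewrite /u coefD coefZ coefXn eqxx mulr1 nth_default // addr0 eqxx; split=> //.
    rewrite (leq_trans (size_polyD _ _)) // geq_max (leq_trans sh) // andbT.
    by rewrite (leq_trans (size_scale_leq _ _)) // size_polyXn.
  by rewrite addrAC subrr add0r.
- rewrite /u [_ *: _ + _]addrC subrK; split=> //; apply/leq_sizeP => j; rewrite leq_eqVlt coefB coefZ coefXn.
  case/predU1P => [<-|tj]; first by rewrite eqxx mulr1 az subrr.
  by rewrite nth_default ?(leq_trans sa) // gtn_eqF // mulr0 subrr.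
Qed.

(** The part of [L] from degree [k] is a sum of twisted Gauss sums. Summing over [f] first,
    [sum_monic_e_frac] restricts [a] to degree at most [t = D - 1 - k] and yields a factor [q^k]
    that cancels [1 / |f|]. *)
Lemma gauss_sum_L_function : (0 < D)%N ->
  gauss_sum pcharF l chi * L_function (conj_character chi) 1 = \sum_(t < D) leading_coef_sum t.
Proof.
move=> D0; have conjP := conj_dirichlet_character chiP.
have [w cw cw1] := nonprincipal_witness D0.
have cw1' : conj_character chi w != 1.
  by apply: contra_neq cw1 => /(congr1 conjc); rewrite /conj_character conjcK conjc1.
rewrite (@L_function1 _ _ _ D); last 2 first.
- exact: (norm_character_le1 conjP size_l).
- by move=> k Dk; rewrite sum_monic_shift (sum_character_shift conjP size_l _ cw cw1').
rewrite (reindex_inj rev_ord_inj) mulr_sumr /=; apply: eq_bigr => t _.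
set k := (D - t.+1)%N; have kt : (D - k = t.+1)%N by rewrite /k subKn.
rewrite mulrA mulr_sumr.
have qk : ((#|F| ^ k)%N%:R : R[i]) != 0.
  by rewrite pnatr_eq0 expn_eq0 negb_and -lt0n (ltn_trans _ (finRing_gt1 F)).
apply: (canLR (mulfK qk)).
under eq_bigr do rewrite mulrC -(gauss_sum_twist _ D0).
rewrite exchange_big /=.
under eq_bigr do rewrite -mulr_sumr.
have sl : size l = D.-1.+2 by rewrite size_l prednK.
have mk : (D.-1 - k = t)%N by have := ltn_ord t; rewrite /k; lia.
have bD (a : {poly_D F}) : (a : {poly F}) %% l = a.
  by rewrite modp_small // size_l ltnS size_npoly.
under eq_bigr do rewrite (sum_monic_e_frac R pcharF l_monic sl) bD prednK // kt mk.
rewrite /leading_coef_sum mulr_suml.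
rewrite (@sum_npoly_widen F _ t.+1 D predT (fun a => chi a * psi a`_t * (#|F| ^ k)%N%:R)) //.
rewrite [RHS]big_mkcond /=; apply: eq_bigr => a _; rewrite andbT.
by case: leqP => _; rewrite ?mulr0 // -mulrA [_%:R * _]mulrC.
Qed.

End GaussSums.
End PrimitiveCharacters.

(** * The summation formula *)

Section DivisorSums.
Variable F : finFieldType.
Implicit Types (a b d f g h : {poly F}).

Lemma monic_of_degreeM i j d h :
  monic_of_degree i d -> monic_of_degree j (d * h) = (i <= j)%N && monic_of_degree (j - i) h.
Proof.
move=> /andP[md /eqP sd]; rewrite /monic_of_degree monicMl //.
case: (boolP (h \is monic)) => mh; last by rewrite andbF.
have h0 : (0 < size h)%N by rewrite lt0n size_poly_eq0 monic_neq0.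
rewrite size_monicM ?monic_neq0 // sd /=; apply/eqP/andP => [|[ij /eqP ->]]; last by rewrite addnS subnKC.
by move: (size h) h0 => k k0 hij; split; [lia|apply/eqP; lia].
Qed.

Lemma sum_monic_divisors (V : nmodType) n (E : {poly F} -> {poly F} -> V) :
  \sum_(f : {poly_n.+1 F} | monic_of_degree n f)
     \sum_(d : {poly_(size f) F} |
        ((d : {poly F}) \is monic) && ((d : {poly F}) %| (f : {poly F}))) E d f =
  \sum_(i < n.+1) \sum_(d : {poly_i.+1 F} | monic_of_degree i d)
     \sum_(h : {poly_(n - i).+1 F} | monic_of_degree (n - i) h) E d ((d : {poly F}) * h).
Proof.
(* Every [f] has size [n.+1], so the divisors can range over a type independent of [f], and the sums
   can be exchanged. *)
transitivity (\sum_(f : {poly_n.+1 F} | monic_of_degree n f)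
     \sum_(d : {poly_n.+1 F} |
        ((d : {poly F}) \is monic) && ((d : {poly F}) %| (f : {poly F}))) E d f).
  by apply: eq_bigr => f /andP[_ /eqP ->].
rewrite (exchange_big_dep (fun d : {poly_n.+1 F} => (d : {poly F}) \is monic)) /=; last first.
  by move=> f d _ /andP[].
rewrite (sum_monic_by_degree _ (fun d => \sum_(f : {poly_n.+1 F} |
   monic_of_degree n f && ((d \is monic) && (d %| (f : {poly F})))) E d f)).
apply: eq_bigr => i _; apply: eq_bigr => d md.
have /andP[d_monic /eqP sd] := md.
have i_le : (i <= n)%N by rewrite -ltnS.
have d0 : (d : {poly F}) != 0 by exact: monic_neq0.
pose Q f := monic_of_degree n f && (((d : {poly F}) \is monic) && ((d : {poly F}) %| f)).
rewrite (@sum_npoly_reindex F V (n - i).+1 n.+1 (monic_of_degree (n - i)) Q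
  (fun h => (d : {poly F}) * h) (fun f => f %/ d) (E d)) // /Q.
- move=> f _ mf; rewrite (monic_of_degreeM _ _ md) i_le mf d_monic dvdp_mulIl; split=> //.
    by have /andP[_ /eqP ->] : monic_of_degree n ((d : {poly F}) * f) by rewrite (monic_of_degreeM _ _ md) i_le.
  by rewrite mulrC mulpK.
- move=> f _ /and3P[mf _ df]; move: mf; rewrite -(divpK df) mulrC (monic_of_degreeM _ _ md).
  have fd : (d : {poly F}) * (f %/ d) %/ d = f %/ d by rewrite mulrC mulpK.
  by rewrite fd => /andP[_ mf]; split=> //; case/andP: mf => _ /eqP ->.
Qed.

Lemma sum_scaled_monic (V : nmodType) i (E : {poly F} -> V) :
  \sum_(z : F | z != 0) \sum_(d : {poly_i.+1 F} | monic_of_degree i d) E (z *: (d : {poly F})) =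
  \sum_(a : {poly_i.+1 F} | size a == i.+1) E a.
Proof.
rewrite [RHS](partition_big (fun a : {poly_i.+1 F} => lead_coef a) (fun z => z != 0)) /=; last first.
  by move=> a /eqP sa; rewrite lead_coef_eq0 -size_poly_eq0 sa.
apply: eq_bigr => z z0.
rewrite (@sum_npoly_reindex F V i.+1 i.+1 (monic_of_degree i)
   (fun a => (size a == i.+1) && (lead_coef a == z)) (fun d => z *: d) (fun a => z^-1 *: a) E) //.
- move=> d sd /andP[/monicP ld /eqP szd].
  by rewrite size_scale // szd lead_coefZ ld mulr1 !eqxx scalerA mulVf // scale1r.
- move=> a sa /andP[/eqP sza /eqP lz]; rewrite scalerA mulfV // scale1r.
  rewrite size_scale ?invr_eq0 // /monic_of_degree size_scale ?invr_eq0 // monicE lead_coefZ lz.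
  by rewrite mulVf // sza !eqxx.
Qed.

(** Below the degree of [g], the remainder is the only possible representative of a class. *)
Lemma sum_small_residue (V : nmodType) D N g b (P : pred {poly F}) (E : {poly F} -> V) :
  size g = D.+1 -> (N <= D)%N ->
  \sum_(a : {poly_N F} | P a && (g %| (a : {poly F}) - b)) E a =
  if (size (b %% g)%R <= N)%N && P (b %% g) then E (b %% g) else 0.
Proof.
move=> sg ND; have g0 : g != 0 by rewrite -size_poly_eq0 sg.
have aE (a : {poly_N F}) : (g %| (a : {poly F}) - b) = ((a : {poly F}) == b %% g).
  by rewrite modp_eqE // modp_small // sg ltnS (leq_trans (size_npoly a)).
under eq_bigl do rewrite aE.
case: (leqP (size (b %% g)%R) N) => sb /=; last first.
  rewrite big_pred0 // => a; apply/negP => /andP[_ /eqP ab].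
  by move: sb; rewrite -ab ltnNge size_npoly.
have bE := npolypK sb; case: ifP => Pb.
  rewrite (big_pred1 (npolyp N (b %% g))) ?bE // => a /=.
  by rewrite -[RHS](inj_eq val_inj) /= bE; case: eqP => [->|]; rewrite ?Pb ?andbF.
by rewrite big_pred0 // => a; apply/negP => /andP[Pa /eqP ab]; rewrite ab Pb in Pa.
Qed.

End DivisorSums.

Lemma sum_triangle (V : nmodType) (L : nat) (E : nat -> nat -> V) :
  \sum_(i < L) \sum_(s < L - i) E i s = \sum_(t < L) \sum_(i < t.+1) E i (L.-1 - t)%N.
Proof.
transitivity (\sum_(i < L) \sum_(t < L | (i < t.+1)%N) E i (L.-1 - t)%N).
  apply: eq_bigr => i _.
  rewrite (big_ord_widen L (E i)) ?leq_subr // [RHS](reindex_inj rev_ord_inj) /=.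
  by apply: eq_big => s => [|_]; [have := ltn_ord s; lia|congr (E i _); have := ltn_ord s; lia].
rewrite (exchange_big_dep xpredT) //=; apply: eq_bigr => t _.
by rewrite (big_ord_widen L (fun i => E i (L.-1 - t)%N)) ?ltn_ord.
Qed.

Lemma sum_shift_index (V : nmodType) (n m : nat) (E : nat -> V) :
  \sum_(i < n | (m <= i)%N) E (i - m)%N = \sum_(i < n - m) E i.
Proof.
transitivity (\sum_(m <= i < n) E (i - m)%N); first by rewrite big_geq_mkord.
rewrite -{1}[m]add0n big_addn big_mkord.
by apply: eq_bigr => i _; rewrite addnK.
Qed.

(** The bounds [deg g] and [nu + 1] to be compared can be in either order, hence [minn] and
    [maxn]. *)
Lemma sum_ord_zero_tail (V : nmodType) (Z : nat -> V) A B :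
  (forall t, (minn A B <= t < maxn A B)%N -> Z t = 0) -> \sum_(t < A) Z t = \sum_(t < B) Z t.
Proof.
wlog AB : A B / (A <= B)%N.
  move=> wl; case/orP: (leq_total A B) => AB; first exact: wl.
  by move=> ZAB; symmetry; apply: wl => // t; rewrite minnC maxnC; exact: ZAB.
move=> Z0; rewrite (big_ord_widen B Z) // big_mkcond; apply: eq_bigr => t _.
case: ltnP => // At; rewrite Z0 //; have := ltn_ord t; lia.
Qed.

(** For fixed [t], put [i = k - (m - t)] and [tau = N - (m - t) - 1 - s]. The second argument of [B]
    no longer involves [i], so the sum over [i <= tau] can be collected into polynomials of degree
    at most [tau]. *)
Lemma convolution_reindex (A : comPzRingType) (q : A) m N (B Delta : nat -> nat -> A) :
  \sum_(k < N) (\sum_(s < (N.-1 - k).+1) B (N.-1 - k - s)%N s) *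
     \sum_(t < m.+1 | (m <= k + t)%N) q ^+ (m - t) * Delta (k + t - m)%N t =
  \sum_(t < m.+1) q ^+ (m - t) * \sum_(tau < N - (m - t)) \sum_(i < tau.+1)
     B (tau - i)%N ((N - (m - t)).-1 - tau)%N * Delta i t.
Proof.
under eq_bigr do rewrite mulr_sumr.
rewrite (exchange_big_dep xpredT) //=; apply: eq_bigr => t _.
set j := (m - t)%N; have tm : (t <= m)%N by rewrite -ltnS.
pose E i := (\sum_(s < (N.-1 - (i + j)).+1) B (N.-1 - (i + j) - s)%N s) * Delta i t.
transitivity (q ^+ j * \sum_(k < N | (j <= k)%N) E (k - j)%N).
  rewrite mulr_sumr; apply: eq_big => [k|k]; first by rewrite /j; lia.
  rewrite /E => mk; rewrite subnK; last by rewrite /j; lia.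
  by rewrite mulrCA; congr (_ * (_ * Delta _ _)); rewrite /j; lia.
congr (_ * _); rewrite sum_shift_index.
transitivity (\sum_(i < N - j) \sum_(s < N - j - i) B ((N - j).-1 - i - s)%N s * Delta i t).
  apply: eq_bigr => i _; rewrite /E mulr_suml.
  have iN := ltn_ord i.
  have -> : ((N.-1 - (i + j)).+1 = N - j - i)%N by lia.
  by apply: eq_bigr => s _; congr (B _ _ * _); lia.
rewrite (sum_triangle _ (fun i s => B ((N - j).-1 - i - s)%N s * Delta i t)).
apply: eq_bigr => tau _; apply: eq_bigr => i _; congr (B _ _ * _).
by have := ltn_ord tau; have := ltn_ord i; lia.
Qed.

Section GeneralizedBinomials.
Variable R : realType.

Let fact_neq0 j : (j`!%:R : R[i]) != 0.
Proof. by rewrite pnatr_eq0 -lt0n fact_gt0. Qed.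

Lemma prod_opp1_sub j : \prod_(i < j) (- 1%:R - i%:R) = (-1) ^+ j * j`!%:R :> R[i].
Proof.
elim: j => [|j IH]; first by rewrite big_ord0 mul1r.
by rewrite big_ord_recr /= IH factS natrM exprS -natr1; ring.
Qed.

Lemma prod_opp2_sub j : \prod_(i < j) (- 2%:R - i%:R) = (-1) ^+ j * j.+1`!%:R :> R[i].
Proof.
elim: j => [|j IH]; first by rewrite big_ord0 mul1r.
by rewrite big_ord_recr /= IH [in RHS]factS natrM exprS -!natr1; ring.
Qed.

Lemma gbinom_opp0 j : gbinom (- 0%:R : R[i]) j = (j == 0)%:R.
Proof.
rewrite /gbinom; case: j => [|j]; first by rewrite big_ord0 divr1.
by rewrite big_ord_recl /= (_ : - 0%:R - 0%:R = 0) ?mul0r // mulr0n oppr0 addr0.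
Qed.

(** The signs in [b_coef] turn the binomials into the coefficients of [1 / (1 - u)] here and of its
    square in [gbinom_opp2]. *)
Lemma gbinom_opp1 j : (-1) ^+ j * gbinom (- 1%:R : R[i]) j = 1.
Proof. by rewrite /gbinom prod_opp1_sub !mulrA -exprMn mulrNN mulr1 expr1n mul1r divff. Qed.

Lemma gbinom_opp2 j : (-1) ^+ j * gbinom (- 2%:R : R[i]) j = j.+1%:R.
Proof.
rewrite /gbinom prod_opp2_sub !mulrA -exprMn mulrNN mulr1 expr1n mul1r.
by rewrite factS natrM mulfK.
Qed.

End GeneralizedBinomials.

(** * Both sides as sums over pairs [(d, a)] with [a = c d] modulo [g] *)

Section VoronoiSums.
Variables (R : realType) (p : nat) (F : finFieldType) (pcharF : p \in [pchar F]).
Variables (g l : {poly F}) (m D : nat) (chi : {poly F} -> R[i]).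
Implicit Types (a b c d f h : {poly F}).

Local Notation psi := (e_q R pcharF).
Local Notation q := (#|F|%:R : R[i]).
Local Notation U := (leading_coef_sum chi pcharF).

(* [sum_j phi x j u^j = psi x + u / (1 - u)]: if [a] has degree [e] and leading
   coefficient [x], then [phi x j] is [psi a`_(e + j)]. *)
Definition phi (x : F) (j : nat) : R[i] := if j is 0 then psi x else 1.

(** Both sides are the coefficient of [u^k] in the sum over [z] of [chi z (psi (- z) + u / (1 - u))
    (psi (lam / z) + u / (1 - u))]; [eta1] and [eta2] select the terms of the expanded product. *)
Lemma sum_b_coef k lam :
  \sum_(eta1 < 2) \sum_(eta2 < 2) b_coef pcharF chi k lam eta1 eta2 =
  \sum_(z | z != 0) chi z%:P * \sum_(s < k.+1) phi (- z) (k - s) * phi (lam / z) s.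
Proof.
have kl (a b : F) : kloosterman pcharF chi a b = \sum_(z | z != 0) chi z%:P * (psi (a * z) * psi (b / z)).
  by apply: eq_bigr => z _; rewrite e_qD.
pose b := b_coef pcharF chi k lam.
transitivity (b 0%N 0%N + b 0%N 1%N + (b 1%N 0%N + b 1%N 1%N)).
  by rewrite !big_ord_recl !big_ord0 !addr0.
have b00 : b 0%N 0%N = (k == 0%N)%:R * kloosterman pcharF chi (- 1) lam.
  rewrite /b /b_coef addn0 subn0 gbinom_opp0 sub0r subr0 mul1r.
  by case: k {b} => [|k] /=; rewrite ?expr0 ?mulr0 ?mul0r // !mul1r mulr1.
have b01 : b 0%N 1%N = (0 < k)%N%:R * kloosterman pcharF chi (- 1) 0.
  rewrite /b /b_coef add0n sub0r subrr mul0r; case: ifP => _; last by rewrite mul0r.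
  by rewrite mulrAC gbinom_opp1.
have b10 : b 1%N 0%N = (0 < k)%N%:R * kloosterman pcharF chi 0 lam.
  rewrite /b /b_coef addn0 subrr subr0 mul1r; case: ifP => _; last by rewrite mul0r.
  by rewrite mulrAC gbinom_opp1.
have b11 : b 1%N 1%N = k.-1%:R * kloosterman pcharF chi 0 0.
  rewrite /b /b_coef subrr mul0r addn1; case: ltnP => k1.
    by rewrite mulrAC gbinom_opp2; congr (_%:R * _); lia.
  by rewrite (_ : k.-1 = 0%N) ?mul0r //; lia.
rewrite b00 b01 b10 b11 {b b00 b01 b10 b11} !kl.
have phi0 z : psi (0 * z) = 1 by rewrite mul0r e_q0.
rewrite !mulr_sumr -!big_split /=; apply: eq_bigr => z _; rewrite mulN1r !phi0.
case: k => [|k] /=; first by rewrite big_ord1 /=; ring.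
(* Only the end terms [s = 0] and [s = k + 1] carry a value of [psi]; the [k] terms between them are
   1. *)
rewrite -(big_mkord xpredT (fun s => phi (- z) (k.+1 - s) * phi (lam / z) s)).
rewrite big_nat_recl // big_nat_recr // subn0 subnn (eq_big_nat _ _ (F2 := fun=> 1)); last first.
  move=> i ik; have -> : (k.+1 - i.+1 = (k - i.+1).+1)%N by lia.
  by rewrite /= mulr1.
by rewrite sumr_const_nat subn0 /=; ring.
Qed.

(* With [X = u / (1 - u)] and [Y = v / (1 - v)], the sum over [z != 0] of
   [(psi (- z) + X) (psi (z x) + Y)] is [q [x == 1] - 1 - X - Y + (q - 1) X Y], and
   the last four terms cancel when [q u v = 1]: the -1 is what truncation leaves. *)
Lemma kernel_sum (b : {poly F}) v w x :
  b != 0 ->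
  \sum_(t < x | (v <= w + t)%N) q ^+ (x.-1 - t) *
     \sum_(z | z != 0) phi (- z) (w + t - v) * (if (size b <= t.+1)%N then psi (z * b`_t) else 0)
  = if (size b <= x)%N && (v < w + x)%N then
      (if (b \is monic) && ((size b).-1 + w == v)%N then q ^+ (x - (size b).-1) else 0) - 1
    else 0.
Proof.
move=> b0; have s0 : (0 < size b)%N by rewrite lt0n size_poly_eq0.
set i := (size b).-1; have sE : size b = i.+1 by rewrite prednK.
have lead : b`_i != 0 by rewrite -lead_coef_eq0 in b0.
have mon : (b \is monic) = (b`_i == 1) by rewrite monicE.
have sN1 (c : F) : c != 0 -> \sum_(z | z != 0) psi (z * c) = -1 :> R[i].
  by move=> c0; rewrite sum_e_q_mulr_neq0 (negPf c0) sub0r.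
rewrite sE; elim: x => [|x IH]; first by rewrite big_ord0 ltn0.
rewrite big_mkcond big_ord_recr /= -big_mkcond /=.
have -> : \sum_(t < x | (v <= w + t)%N) q ^+ (x - t) *
     \sum_(z | z != 0) phi (- z) (w + t - v) * (if (i < t.+1)%N then psi (z * b`_t) else 0)
  = q * (if (i < x)%N && (v < w + x)%N then
      (if (b \is monic) && (i + w == v)%N then q ^+ (x - i) else 0) - 1 else 0).
  rewrite -IH mulr_sumr; apply: eq_bigr => t _; rewrite mulrA -exprS; congr (q ^+ _ * _).
  by have := ltn_ord t; lia.
rewrite subnn expr0 mul1r addnS !ltnS.
(* Above the degree of [b] the new term is [q - 1], which restores -1 from [q] times -1, or a first
   -1 when [v = w + x]. At [x = i] orthogonality detects whether [b] is monic. *)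
case: (ltngtP i x) => [ix|xi|<-].
- rewrite [b`_x]nth_default ?sE //.
  case: (ltngtP v (w + x)%N) => [vw|wv|vE] /=.
  + have -> : (w + x - v = (w + x - v).-1.+1)%N by lia.
    rewrite /= (eq_bigr (fun=> 1)); last by move=> z _; rewrite mulr0 e_q0 mulr1.
    have q1 : \sum_(z : F | z != 0) (1 : R[i]) = q - 1.
      by have := sum_e_q_mulr_neq0 R pcharF 0; under eq_bigr do rewrite mulr0 e_q0; rewrite eqxx.
    rewrite q1 subSn; last exact: ltnW.
    by case: ifP => _; rewrite ?exprS; ring.
  + by rewrite mulr0 addr0.
  + rewrite vE subnn mulr0 add0r /= (eq_bigr (fun z => psi (z * -1))); last first.
      by move=> z _; rewrite mulr0 e_q0 mulr1 mulrN1.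
    rewrite sN1 ?oppr_eq0 ?oner_eq0 // (_ : (i + w == w + x)%N = false) ?andbF ?sub0r //.
    by lia.
- rewrite mulr0 add0r; case: ifP => // _; rewrite big1 // => z _; by rewrite mulr0.
- rewrite mulr0 add0r andTb; case: (ltngtP v (w + i)%N) => [vw|wv|vE].
  + have -> : (w + i - v = (w + i - v).-1.+1)%N by lia.
    rewrite /=; under eq_bigr do rewrite mul1r.
    by rewrite sN1 // (_ : (i + w == v)%N = false) ?andbF ?sub0r //; lia.
  + by [].
  + rewrite vE subnn /= [(i + w)%N]addnC eqxx andbT subSnn expr1.
    rewrite (eq_bigr (fun z => psi (z * (b`_i - 1)))); last first.
      by move=> z _; rewrite -e_qD mulrBr mulr1 addrC.
    by rewrite sum_e_q_mulr_neq0 subr_eq0 mon.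
Qed.

(** For [t <= m] there is at most one such [a]; allowing larger [t] gives sums that vanish. *)
Definition residue_sum t b : R[i] :=
  \sum_(a : {poly_t.+1 F} | g %| (a : {poly F}) - b) psi (a : {poly F})`_t.

Definition dual_sum c i t : R[i] :=
  \sum_(d : {poly_i.+1 F} | monic_of_degree i d) chi d * residue_sum t (c * (d : {poly F})).

Hypotheses (chiP : dirichlet_character l chi) (size_l : size l = D.+1) (D_gt0 : (0 < D)%N).

Lemma character_multiple_eq0 a : l %| a -> chi a = 0.
Proof.
move=> la; apply: (character_eq0 chiP); rewrite coprimep_def.
by rewrite (eqp_size (dvdp_gcd_idr la)) size_l eqSS -lt0n.
Qed.

(* The substitution [a = - z d], [lam = - z r]. *)
Lemma sum_phi_dual (Psi : {poly F} -> R[i]) c tau s :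
  \sum_(i < tau.+1) \sum_(lam | lam != 0)
    (\sum_(z | z != 0) chi z%:P * (phi (- z) (tau - i) * phi (lam / z) s)) *
    \sum_(d : {poly_i.+1 F} | monic_of_degree i d) chi d * Psi (lam%:P * c * (d : {poly F})) =
  chi (- 1) * \sum_(a : {poly_tau.+1 F}) chi a * psi (a : {poly F})`_tau *
    \sum_(r | r != 0) phi (- r) s * Psi (r%:P * c * (a : {poly F})).
Proof.
pose H a := chi (- 1) * (chi a * psi a`_tau * \sum_(r | r != 0) phi (- r) s * Psi (r%:P * c * a)).
have H0 : H 0 = 0 by rewrite /H (character_multiple_eq0 (dvdp0 l)) !mul0r mulr0.
rewrite mulr_sumr -/(H _).
have -> : \sum_(a : {poly_tau.+1 F}) H a =
    \sum_(a : {poly_tau.+1 F} | (a : {poly F}) != 0) H a.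
  rewrite [RHS]big_mkcond; apply: eq_bigr => a _; case: eqP => [->|] //=.
rewrite (@sum_npoly_by_degree F _ _ (fun a => a != 0)) ?eqxx //.
apply: eq_bigr => i _.
transitivity (\sum_(a : {poly_i.+1 F} | size a == i.+1) H a); last first.
  apply: eq_bigl => a; rewrite andb_idl // => /eqP sa.
  by rewrite -size_poly_eq0 sa.
rewrite -sum_scaled_monic [RHS](reindex_inj oppr_inj) /=.
under [RHS]eq_bigl do rewrite oppr_eq0.
under eq_bigr do rewrite mulr_suml.
rewrite exchange_big /=; apply: eq_bigr => z z0.
under eq_bigr do rewrite mulr_sumr.
rewrite exchange_big /=; apply: eq_bigr => d /andP[d_monic /eqP sd].
rewrite (reindex_inj (mulfI (_ : - z != 0))) ?oppr_eq0 //= /H.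
under eq_bigl do rewrite mulf_eq0 oppr_eq0 (negPf z0) /=.
have -> : psi (- z *: (d : {poly F}))`_tau = phi (- z) (tau - i).
  have i_le : (i <= tau)%N by rewrite -ltnS.
  rewrite coefZ; have := monicP d_monic; rewrite /lead_coef sd /=.
  case: (ltngtP i tau) i_le => // [it|it] _ di.
    rewrite nth_default ?sd // mulr0 e_q0.
    by have -> : (tau - i = (tau - i).-1.+1)%N by lia.
  have -> : (d : {poly F})`_tau = 1 by rewrite -di; congr nth.
  by rewrite mulr1 (_ : (tau - i = 0)%N) //; lia.
have -> : chi (- z *: (d : {poly F})) = chi (- 1) * (chi z%:P * chi d).
  by rewrite -!(character_mul chiP) -mul_polyC polyCN !mulNr mul1r.
rewrite [RHS](_ : _ = (chi (-1) * chi (-1)) * (chi z%:P * chi d * phi (- z) (tau - i) *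
  \sum_(r | r != 0) phi (- r) s * Psi (r%:P * c * (- z *: (d : {poly F}))))); last by ring.
rewrite -(character_mul chiP) mulrNN mulr1 (character_one chiP) mul1r mulr_sumr.
apply: eq_bigr => r r0.
have -> : - z * r / z = - r by field.
have -> : (- z * r)%:P * c * d = r%:P * c * (- z *: (d : {poly F})).
  by rewrite -mul_polyC polyCM; ring.
by ring.
Qed.

(** Here [N] stands for [nu + 1], so that [N = 0] is the empty sum. [sum_b_coef] splits the
    coefficients into two [phi] factors; after [convolution_reindex], [sum_phi_dual] absorbs one
    into [a] and leaves the other on the residues of [r c a]. *)
Lemma dual_side c N :
  \sum_(lam | lam != 0) \sum_(eta1 < 2) \sum_(eta2 < 2) \sum_(0 <= k < N)
    b_coef pcharF chi (N.-1 - k) lam eta1 eta2 *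
    (\sum_(t < m.+1 | (m <= k + t)%N) q ^+ (m - t) * dual_sum (lam%:P * c) (k + t - m)%N t) =
  chi (- 1) * \sum_(tau < N) \sum_(a : {poly_tau.+1 F}) chi a * psi (a : {poly F})`_tau *
    \sum_(t < m.+1 | (tau + m.+1 <= N + t)%N) q ^+ (m - t) *
      \sum_(r | r != 0) phi (- r) (N + t - (tau + m.+1))%N * residue_sum t (r%:P * c * (a : {poly F})).
Proof.
pose A lam u s := \sum_(z | z != 0) chi z%:P * (phi (- z) u * phi (lam / z) s).
transitivity (\sum_(lam | lam != 0) \sum_(t < m.+1) q ^+ (m - t) *
  \sum_(tau < N - (m - t)) \sum_(i < tau.+1)
     A lam (tau - i)%N ((N - (m - t)).-1 - tau)%N * dual_sum (lam%:P * c) i t).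
  apply: eq_bigr => lam _.
  rewrite -(convolution_reindex q m N (A lam) (dual_sum (lam%:P * c))).
  under eq_bigr do rewrite exchange_big /=.
  rewrite exchange_big /= big_mkord; apply: eq_bigr => k _.
  under eq_bigr do rewrite -mulr_suml.
  rewrite -mulr_suml sum_b_coef; congr (_ * _).
  under [LHS]eq_bigr do rewrite mulr_sumr.
  by rewrite exchange_big.
rewrite exchange_big /=.
transitivity (\sum_(t < m.+1) \sum_(tau < N | (tau + m.+1 <= N + t)%N) \sum_(a : {poly_tau.+1 F})
  chi (- 1) * (chi a * psi (a : {poly F})`_tau * (q ^+ (m - t) *
   \sum_(r | r != 0) phi (- r) (N + t - (tau + m.+1))%N * residue_sum t (r%:P * c * (a : {poly F}))))).
  apply: eq_bigr => t _; rewrite -mulr_sumr exchange_big /=.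
  pose G (tau : nat) := chi (- 1) * \sum_(a : {poly_tau.+1 F}) chi a * psi (a : {poly F})`_tau *
    \sum_(r | r != 0) phi (- r) ((N - (m - t)).-1 - tau)%N * residue_sum t (r%:P * c * (a : {poly F})).
  transitivity (q ^+ (m - t) * \sum_(tau < N - (m - t)) G tau).
    congr (_ * _); apply: eq_bigr => tau _; rewrite exchange_big /= /G -sum_phi_dual.
    by apply: eq_bigr => i _; apply: eq_bigr => lam _.
  have tm : (t <= m)%N by rewrite -ltnS.
  rewrite (big_ord_widen N G) ?leq_subr // mulr_sumr; apply: eq_big => [tau|tau]; first by lia.
  move=> htau; rewrite /G mulrCA !mulr_sumr; apply: eq_bigr => a _; congr (_ * _).
  rewrite mulrCA; congr (_ * (_ * _)); apply: eq_bigr => r _; congr (phi _ _ * _).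
  by lia.
rewrite (exchange_big_dep xpredT) //= mulr_sumr; apply: eq_bigr => tau _.
rewrite mulr_sumr exchange_big /=; apply: eq_bigr => a _.
by rewrite !mulr_sumr.
Qed.

Hypotheses (g_monic : g \is monic) (size_g : size g = m.+2) (l_dvd_g : l %| g).

Let g_neq0 : g != 0. Proof. exact: monic_neq0. Qed.

Lemma residue_sum_small t b : (t <= m)%N ->
  residue_sum t b = if (size (b %% g)%R <= t.+1)%N then psi (b %% g)`_t else 0.
Proof.
move=> tm.
have := sum_small_residue b predT (fun a => psi a`_t) size_g (tm : (t.+1 <= m.+1)%N).
by rewrite andbT.
Qed.

(** From degree [deg g] on, [g] has multiples with any prescribed coefficient at [T^t], and
    translating by them preserves the class. *)
Lemma residue_sum_eq0 t b : (m < t)%N -> residue_sum t b = 0.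
Proof.
move=> mt; have [y ey] := e_q_nontrivial R pcharF.
pose v : {poly F} := (y *: 'X^(t - m.+1)) * g.
have gv : g %| v by rewrite dvdp_mull.
have sv : (size v <= t.+1)%N.
  rewrite /v (leq_trans (size_polyMleq _ _)) // size_g.
  have := size_scale_leq y ('X^(t - m.+1) : {poly F}); rewrite size_polyXn.
  by move: (size (y *: 'X^_ : {poly F})) => u; lia.
have vt : v`_t = y.
  rewrite /v -scalerAl coefZ coefXnM.
  have -> : (t < t - m.+1)%N = false by lia.
  have -> : (t - (t - m.+1) = m.+1)%N by lia.
  by have := monicP g_monic; rewrite /lead_coef size_g /= => ->; rewrite mulr1.
rewrite /residue_sum big_mkcond /=.
apply: (sum_eigen_eq0 (addrI (npolyp t.+1 v)) _ ey) => a.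
rewrite /= npolypK // -addrA dvdp_addr // coefD vt e_qD.
by case: ifP => _; rewrite ?mulr0.
Qed.

Lemma dual_sum_eq0 c i t : (m < t)%N -> dual_sum c i t = 0.
Proof.
by move=> mt; rewrite /dual_sum big1 // => d _; rewrite residue_sum_eq0 // mulr0.
Qed.

Lemma residue_sum_mod t b : residue_sum t (b %% g) = residue_sum t b.
Proof.
apply: eq_bigl => a; rewrite !(modp_eqE _ _ g_neq0) modp_id.
by [].
Qed.

(** The monic [d] of degree [i] are equidistributed modulo [g]. Each [a] then determines the class
    of [d] as that of [c' a], where [chi] equals [conj (chi c) chi a]. *)
Lemma dual_sum_large c c' i t : g %| c * c' - 1 -> (m < i)%N ->
  dual_sum c i t = conj_character chi c * U t *+ #|F| ^ (i - m.+1).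
Proof.
move=> cc' mi; have lcc' : l %| c * c' - 1 := dvdp_trans l_dvd_g cc'.
pose E r := chi r * residue_sum t (c * r).
have Emod r : E (r %% g) = E r.
  rewrite /E -[in LHS]residue_sum_mod modp_mul residue_sum_mod; congr (_ * _).
  by apply: (character_periodic chiP); apply: (dvdp_trans l_dvd_g); rewrite modp_eqE // modp_id.
rewrite /dual_sum (sum_monic_shift _ E).
under eq_bigr do rewrite -Emod.
rewrite (sum_equidistributed _ _ size_g mi); congr (_ *+ _).
rewrite /E; under eq_bigr do rewrite mulr_sumr.
rewrite (exchange_big_dep xpredT) //= /leading_coef_sum mulr_sumr; apply: eq_bigr => a _.
under eq_bigl do rewrite (dvdp_inverse_swap cc').
have := sum_small_residue (c' * (a : {poly F})) predT (fun r => chi r * psi (a : {poly F})`_t) size_g (leqnn _).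
rewrite /= => ->; rewrite andbT -ltnS -size_g ltn_modp g_neq0.
rewrite (conj_character_inverse chiP size_l lcc') mulrA -(character_mul chiP); congr (_ * _).
by apply: (character_periodic chiP); apply: (dvdp_trans l_dvd_g); rewrite modp_eqE // modp_id.
Qed.

(** Write [f = d h] with [deg d = i] and sum over [h] by [sum_monic_e_frac]; then
    [t = m - (n - i)]. *)
Lemma twisted_divisor_sum n c c' : g %| c * c' - 1 ->
  \sum_(f : {poly_n.+1 F} | monic_of_degree n f)
     r_char chi f * e_frac R pcharF (c * (f : {poly F})) g =
  \sum_(t < m.+1 | (m <= n + t)%N) q ^+ (m - t) * dual_sum c (n + t - m)%N t.
Proof.
move=> cc'.
under eq_bigr do rewrite mulr_suml.
rewrite (sum_monic_divisors n (fun d f => chi d * e_frac R pcharF (c * f) g)).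
pose H i t := q ^+ (m - t) * dual_sum c i t.
transitivity (\sum_(i < n.+1 | (n - i <= m)%N) H i (m - (n - i))%N).
  rewrite [RHS]big_mkcond /=; apply: eq_bigr => i _.
  under eq_bigr do rewrite -mulr_sumr.
  have inner d : \sum_(h : {poly_(n - i).+1 F} | monic_of_degree (n - i) h)
      e_frac R pcharF (c * (d * (h : {poly F}))) g =
    if (size ((c * d) %% g)%R <= m.+1 - (n - i))%N
    then (#|F| ^ (n - i))%:R * psi ((c * d) %% g)`_(m - (n - i)) else 0.
    rewrite -(sum_monic_e_frac R pcharF g_monic size_g).
    by apply: eq_bigr => h _; rewrite mulrA.
  under eq_bigr do rewrite inner.
  (* When [deg h > m] only the [d] divisible by [g] survive, and [chi] kills them. *)
  case: leqP => nim; last first.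
    rewrite big1 // => d _; case: ifP => sz; last by rewrite mulr0.
    have : (c * (d : {poly F})) %% g == 0 by rewrite -size_poly_leq0 (leq_trans sz) //; lia.
    rewrite -/(_ %| _) mulrC Gauss_dvdpl ?(dvdp_trans l_dvd_g) //; last first.
      by rewrite coprimep_sym (inverse_coprimep cc').
    by move=> gd; rewrite character_multiple_eq0 ?mul0r // (dvdp_trans l_dvd_g).
  rewrite /H /dual_sum mulr_sumr; apply: eq_bigr => d _.
  rewrite residue_sum_small ?leq_subr // subKn // subSn // natrX.
  by case: ifP; rewrite ?mulr0 // mulrCA.
rewrite (reindex_onto (fun t : 'I_m.+1 => inord (n + t - m) : 'I_n.+1)
                      (fun i => inord (m - (n - i)) : 'I_m.+1)) /=; last first.
  by move=> i nim; apply: val_inj; rewrite /= !inordK; have := ltn_ord i; lia.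
apply: eq_big => t.
  have tm := ltn_ord t; have i_ok : (n + t - m < n.+1)%N by lia.
  rewrite inordK //; apply/andP/idP => [[h1 /eqP/(congr1 val)] /=|h1].
    by rewrite inordK; lia.
  by split; [lia|apply/eqP/val_inj; rewrite /= inordK; lia].
have tm := ltn_ord t; have i_ok : (n + t - m < n.+1)%N by lia.
rewrite /H inordK // => /andP[h1 /eqP/(congr1 val)] /=.
by rewrite inordK; [move=> ->|lia].
Qed.

Section Inverse.
Variables (c c' : {poly F}).
Hypothesis cc' : g %| c * c' - 1.

Lemma inverse_residue_neq0 a : chi a != 0 -> (c' * a) %% g != 0.
Proof.
apply: contra_neq => /eqP ga; apply: character_multiple_eq0; apply: (dvdp_trans l_dvd_g).
have := dvdp_inverse_swap cc' a 0; rewrite mulr0 subr0 sub0r dvdpNr => ->; exact: ga.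
Qed.

Lemma character_inverse_residue a : chi c * chi ((c' * a) %% g) = chi a.
Proof.
rewrite -(character_mul chiP); apply: (character_periodic chiP); apply: (dvdp_trans l_dvd_g).
by rewrite -opprB dvdpNr (dvdp_inverse_swap cc') -opprB dvdpNr modp_eqE // modp_id.
Qed.

Lemma dual_kernel a tau N : chi a != 0 -> (tau < N)%N ->
  \sum_(t < m.+1 | (tau + m.+1 <= N + t)%N) q ^+ (m - t) *
      \sum_(r | r != 0) phi (- r) (N + t - (tau + m.+1))%N * residue_sum t (r%:P * c' * a) =
  (if ((c' * a) %% g \is monic) && ((size ((c' * a) %% g)%R).-1 + N == tau + m.+1)%N
   then q ^+ (m.+1 - (size ((c' * a) %% g)%R).-1) else 0) - 1.
Proof.
move=> ca tauN; set b := (c' * a) %% g.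
have sb : (size b <= m.+1)%N by rewrite -ltnS -size_g ltn_modp.
have := @kernel_sum b (tau + m.+1) N m.+1 (inverse_residue_neq0 ca).
rewrite sb (_ : (tau + m.+1 < N + m.+1)%N) ?ltn_add2r //= => <-.
apply: eq_bigr => t _; congr (_ * _); apply: eq_bigr => r r0; congr (_ * _).
have E : (r%:P * c' * a) %% g = r *: b by rewrite -mulrA mul_polyC modpZl.
by rewrite residue_sum_small ?E ?size_scale ?coefZ // -ltnS.
Qed.

(* [c' a = d] modulo [g] is the same as [a = c d], which exchanges the two variables. *)
Lemma dual_sum_main tau N : (tau < N)%N ->
  \sum_(a : {poly_tau.+1 F}) chi a * psi (a : {poly F})`_tau *
   (if ((c' * (a : {poly F})) %% g \is monic) &&
       ((size ((c' * (a : {poly F})) %% g)%R).-1 + N == tau + m.+1)%N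
    then q ^+ (m.+1 - (size ((c' * (a : {poly F})) %% g)%R).-1) else 0) =
  if (N <= tau + m.+1)%N
  then q ^+ (N - tau) * (chi c * dual_sum c (tau + m.+1 - N) tau) else 0.
Proof.
move=> tauN; case: leqP => hN; last first.
  by rewrite big1 // => a _; case: ifP => [/andP[_ /eqP]|_]; [lia|rewrite mulr0].
set h := (tau + m.+1 - N)%N; have hm : (h < m.+1)%N by rewrite /h; lia.
rewrite /dual_sum /residue_sum; under [in RHS]eq_bigr do rewrite mulr_sumr.
rewrite [in RHS](exchange_big_dep xpredT) //= !mulr_sumr; apply: eq_bigr => a _.
under eq_bigl do rewrite (dvdp_inverse_swap cc').
rewrite (sum_small_residue (c' * (a : {poly F})) (monic_of_degree h)
  (fun d => chi d * psi (a : {poly F})`_tau) size_g hm).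
set b := (c' * (a : {poly F})) %% g.
have bmon : (size b <= h.+1)%N && monic_of_degree h b = monic_of_degree h b.
  by rewrite andb_idl // => /andP[_ /eqP ->].
have -> : (b \is monic) && ((size b).-1 + N == tau + m.+1)%N = monic_of_degree h b.
  rewrite /monic_of_degree; case: (boolP (b \is monic)) => //= b_monic.
  have : (0 < size b)%N by rewrite lt0n size_poly_eq0 monic_neq0.
  by move: (size b) => u u0; apply/eqP/eqP; rewrite /h; lia.
rewrite bmon; case: ifP => [/andP[_ /eqP sb]|_]; last by rewrite !mulr0.
rewrite (mulrA (chi c)) character_inverse_residue mulrC; congr (q ^+ _ * _).
by rewrite sb /h; lia.
Qed.

End Inverse.

(** * Comparison of the two sides *)

Section Transformation.
Variables (n : nat) (c c' : {poly F}).
Hypothesis cc' : g %| c * c' - 1.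

Let q_neq0 : q != 0.
Proof. by rewrite pnatr_eq0 -lt0n (ltn_trans _ (finRing_gt1 F)). Qed.

(** This is [nu + 1], truncated to 0 when [nu < 0]. *)
Let dg : nat := (2 * m.+1 - n - 1)%N.

(** [dual_kernel] evaluates the inner sum; its first part gives back sums for [c] by
    [dual_sum_main], and its -1 gives [- U tau]. *)
Lemma dual_sumE :
  \sum_(tau < dg) \sum_(a : {poly_tau.+1 F}) chi a * psi (a : {poly F})`_tau *
    \sum_(t < m.+1 | (tau + m.+1 <= dg + t)%N) q ^+ (m - t) *
      \sum_(r | r != 0) phi (- r) (dg + t - (tau + m.+1))%N * residue_sum t (r%:P * c' * (a : {poly F}))
  = \sum_(tau < dg) ((if (m <= n + tau)%N
      then q ^+ (m.+1 - (n + tau - m)) * (chi c * dual_sum c (n + tau - m) tau) else 0) - U tau).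
Proof.
apply: eq_bigr => tau _; have tau_lt := ltn_ord tau.
have dgE : (n + dg = m.+1 + m)%N by move: tau_lt; rewrite /dg; lia.
pose K (a : {poly F}) := if ((c' * a) %% g \is monic) &&
   ((size ((c' * a) %% g)%R).-1 + dg == tau + m.+1)%N
   then q ^+ (m.+1 - (size ((c' * a) %% g)%R).-1) else 0.
transitivity (\sum_(a : {poly_tau.+1 F}) (chi a * psi (a : {poly F})`_tau * K a -
    chi a * psi (a : {poly F})`_tau)).
  apply: eq_bigr => a _; have [ca|ca] := eqVneq (chi a) 0.
    by rewrite ca !mul0r subrr.
  by rewrite (dual_kernel cc' ca tau_lt) -/(K a) mulrBr mulr1.
rewrite sumrB; congr (_ - _); rewrite (dual_sum_main cc' tau_lt).
have -> : (dg <= tau + m.+1)%N = (m <= n + tau)%N by lia.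
case: leqP => // mt; congr (q ^+ _ * (_ * dual_sum _ _ _)); lia.
Qed.

Hypotheses (l_monic : l \is monic) (primP : primitive_character l chi).

(** The left-hand side is the sum of [X t] over [t < deg g], the main term is the sum of [Y t], and
    the dual term is the sum of [X t - Y t] over [t < dg]. So [X] and [Y] need only agree between
    [deg g] and [dg]. *)
Lemma divisor_sum_transformation :
  \sum_(t < m.+1 | (m <= n + t)%N) q ^+ (m - t) * dual_sum c (n + t - m)%N t =
  q ^+ n / q ^+ m.+1 * (gauss_sum pcharF l chi * conj_character chi c *
     L_function (conj_character chi) 1) +
  q ^+ n / q ^+ m.+1 * conj_character chi (- c) *
  (chi (- 1) * \sum_(tau < dg) ((if (m <= n + tau)%N
      then q ^+ (m.+1 - (n + tau - m)) * (chi c * dual_sum c (n + tau - m) tau) else 0) - U tau)).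
Proof.
have ccl : coprimep c l := inverse_coprimep (dvdp_trans l_dvd_g cc').
pose X t := if (m <= n + t)%N then q ^+ n / q ^+ (n + t - m) * dual_sum c (n + t - m)%N t else 0.
pose Y t := q ^+ n / q ^+ m.+1 * conj_character chi c * U t.
have Dm : (D <= m.+1)%N by rewrite -ltnS -size_l -size_g dvdp_leq.
have YD t : (D <= t)%N -> Y t = 0.
  by move=> Dt; rewrite /Y (leading_coef_sum_eq0 primP size_l l_monic) // mulr0.
have tail : \sum_(t < m.+1) (X t - Y t) = \sum_(t < dg) (X t - Y t).
  (* If [t >= deg g], both terms vanish. If [dg <= t < deg g], then [d] has degree
     [n + t - m >= deg g] and [dual_sum_large] applies. *)
  apply: (sum_ord_zero_tail (Z := fun t => X t - Y t)) => t /andP[t1 t2]; rewrite /X.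
  have [mt|tm] := ltnP m t.
    by rewrite YD ?(leq_trans Dm) // dual_sum_eq0 // mulr0; case: ifP; rewrite subrr.
  have nt : (m < n + t - m)%N by move: t1 t2; rewrite /dg; lia.
  have -> : (m <= n + t)%N by lia.
  apply/eqP; rewrite subr_eq0; apply/eqP; rewrite (dual_sum_large _ cc' nt) /Y.
  rewrite -(mulr_natl (conj_character chi c * U t)) natrX mulrA; set k := (n + t - m)%N.
  have -> : q ^+ k = q ^+ m.+1 * q ^+ (k - m.+1) by rewrite -exprD subnKC.
  by rewrite !mulrA; field; rewrite !expf_neq0.
transitivity (\sum_(t < m.+1) X t).
  rewrite big_mkcond; apply: eq_bigr => t _; rewrite /X; case: ifP => // mt.
  have tm := ltn_ord t; rewrite -exprB ?unitfE //; last by lia.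
  by congr (q ^+ _ * _); lia.
have -> : \sum_(t < m.+1) X t = \sum_(t < m.+1) Y t + \sum_(t < dg) (X t - Y t).
  by rewrite -tail sumrB addrC subrK.
congr (_ + _).
  rewrite [gauss_sum _ _ _ * _ * _]mulrAC (gauss_sum_L_function primP size_l l_monic) //.
  rewrite [_ * conj_character chi c]mulrC !mulr_sumr.
  have -> : \sum_(t < m.+1) Y t = \sum_(t < D) Y t.
    apply: sum_ord_zero_tail => t /andP[t1 _]; apply: YD; move: t1; lia.
  by apply: eq_bigr => t _; rewrite /Y mulrA.
rewrite mulrA !mulr_sumr; apply: eq_bigr => tau _; rewrite mulrBr.
have cN : conj_character chi (- c) * chi (- 1) = conj_character chi c.
  rewrite -(mulN1r c) (character_mul (conj_dirichlet_character chiP)) mulrAC.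
  rewrite [_ * chi (-1)]mulrC (mul_conj_character chiP size_l) ?mul1r //.
  by apply: (@inverse_coprimep _ _ (- 1)); rewrite mulrNN mulr1 subrr dvdp0.
rewrite -[_ / _ * _ * _]mulrA cN; congr (_ - _).
rewrite /X; case: ifP => mt; last by rewrite mulr0.
have tau_lt := ltn_ord tau.
set h := (n + tau - m)%N; have hm : (h <= m.+1)%N by move: tau_lt; rewrite /h /dg; lia.
have cc1 : conj_character chi c * chi c = 1 by rewrite mulrC (mul_conj_character chiP size_l).
have regroup (u v w x y : R[i]) : u * v * (w * (x * y)) = u * w * (v * x) * y by ring.
rewrite regroup cc1 mulr1 (exprB hm) ?unitfE //; congr (_ * _).
by rewrite mulrA divfK ?expf_neq0.
Qed.

End Transformation.
End VoronoiSums.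

Theorem proposition4p4
    (R : realType) (p : nat) (F : finFieldType) (pcharF : p \in [pchar F])
    (n : nat) (g l c cbar : {poly F}) (chi : {poly F} -> R[i])
    (g_monic : g \is monic) (g_deg : (1 <= (size g).-1)%N)
    (l_monic : l \is monic) (l_neq1 : l != 1) (l_dvd_g : l %| g)
    (c_coprime_g : coprimep c g) (cbar_inverse : g %| c * cbar - 1)
    (chi_primitive : primitive_character l chi) :
  let q := #|F| in
  let chibar := conj_character chi in
  \sum_(f : {poly_n.+1 F} | monic_of_degree n f)
    r_char chi f * e_frac R pcharF (c * (f : {poly F})) g
  = (q ^ n)%:R / (norm_poly g)%:R * gauss_sum pcharF l chi
      * chibar c * L_function chibar 1
    + (q ^ n)%:R / (norm_poly g)%:R * chibar (- c)
      * \sum_(lam : F | lam != 0) \sum_(eta1 < 2) \sum_(eta2 < 2)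
          (* nu = 2 deg g - n - 2, and k ranges over 0 <= k <= nu *)
          \sum_(0 <= k < 2 * (size g).-1 - n - 1)
            b_coef pcharF chi (2 * (size g).-1 - n - 2 - k) lam eta1 eta2
            * \sum_(f : {poly_k.+1 F} | monic_of_degree k f)
                r_char chi f
                * e_frac R pcharF (lam%:P * cbar * (f : {poly F})) g.
Proof.
move=> q chibar.
have chiP : dirichlet_character l chi := chi_primitive.1.
have [m size_g] : exists m, size g = m.+2.
  by exists (size g).-2; move: g_deg; move: (size g) => u; lia.
have [D size_l] : exists D, size l = D.+1.
  by exists (size l).-1; rewrite prednK // lt0n size_poly_eq0 monic_neq0.
have D_gt0 : (0 < D)%N.
  rewrite lt0n; apply: contra_neq l_neq1 => D0; apply/eqP.
  by move/monicP: l_monic; rewrite [l]size1_polyC ?size_l ?D0 // lead_coefC => ->.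
have deg_g : ((size g).-1 = m.+1)%N by rewrite size_g.
(* The inner sums on the right are twisted divisor sums for [lam cbar], which needs its own inverse
   modulo [g]. *)
have lam_inverse (lam : F) : lam != 0 -> g %| lam%:P * cbar * (lam^-1%:P * c) - 1.
  move=> lam0; rewrite (_ : _ * _ = (lam%:P * lam^-1%:P) * (c * cbar)); last by ring.
  by rewrite -polyCM mulfV // mul1r.
rewrite (twisted_divisor_sum pcharF chiP size_l D_gt0 g_monic size_g l_dvd_g n cbar_inverse).
rewrite (divisor_sum_transformation pcharF chiP size_l D_gt0 g_monic size_g l_dvd_g n cbar_inverse
  l_monic chi_primitive).
rewrite /norm_poly deg_g !natrX; congr (_ + _); first by rewrite !mulrA.
congr (_ * _).
(* The remaining bracket is folded back into the sum over [lam], [eta1], [eta2] and [k]. *)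
rewrite -(dual_sumE pcharF chiP size_l D_gt0 g_monic size_g l_dvd_g n cbar_inverse).
rewrite -(dual_side pcharF g m chiP size_l D_gt0).
apply: eq_bigr => lam lam0; apply: eq_bigr => eta1 _; apply: eq_bigr => eta2 _.
apply: eq_bigr => k _; congr (b_coef _ _ _ _ _ _ * _).
  by lia.
by rewrite (twisted_divisor_sum pcharF chiP size_l D_gt0 g_monic size_g l_dvd_g k (lam_inverse _ lam0)).
Qed.
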